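(* Let $P$ be a finite poset. Then the exact category $\mathcal{E}_{\operatorname{Rk}}$ (that is, $\operatorname{rep}P$ with the rank-exact sequences) has enough projectives, which are the finite direct sums of lower hook modules $\mathbf{k}_{\langle i,j\langle}$ ($i<j\in P\cup\{\infty\}$), and enough injectives, which are the finite direct sums of upper hook modules $\mathbf{k}_{\rangle i,j\rangle}$ ($i<j\in P\cup\{-\infty\}$). Moreover, every object has a finite $\mathcal{E}_{\operatorname{Rk}}$-projective resolution and a finite $\mathcal{E}_{\operatorname{Rk}}$-injective resolution.
   Context: Fix a field $\mathbf{k}$. $\operatorname{rep}P$ is the category of functors from the poset $P$ to finite-dimensional $\mathbf{k}$-vector spaces. For $M\in\operatorname{rep}P$ and $s\le t$ in $P$, $\operatorname{Rk}M(s,t)=\operatorname{rank}[M(s)\to M(t)]$. A short exact sequence $0\to A\to B\to C\to0$ in $\operatorname{rep}P$ is rank-exact if $\operatorname{Rk}B=\operatorname{Rk}A+\operatorname{Rk}C$; the rank-exact sequences form an exact structure $\mathcal{E}_{\operatorname{Rk}}$ on $\operatorname{rep}P$, whose admissible epics (monics) are the second (first) maps of rank-exact sequences. For a convex subset $I\subseteq P$, $\mathbf{k}_I$ is the representation equal to $\mathbf{k}$ on $I$, $0$ elsewhere, with identity maps between comparable elements of $I$. With the convention $-\infty<p<\infty$ for all $p\in P$: lower hooks are $\langle i,j\langle=\{\ell\in P\mid i\le\ell\not\ge j\}$ for $i\in P$, $j\in P\cup\{\infty\}$, $i<j$; upper hooks are $\rangle i,j\rangle=\{\ell\in P\mid i\not\ge\ell\le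 j\}$ for $i\in P\cup\{-\infty\}$, $j\in P$, $i<j$. An object $X$ is $\mathcal{E}_{\operatorname{Rk}}$-projective (resp. $\mathcal{E}_{\operatorname{Rk}}$-injective) if $\operatorname{Hom}(X,-)$ (resp. $\operatorname{Hom}(-,X)$) takes rank-exact sequences to short exact sequences. Enough projectives: every object $A$ admits an admissible epic $X\to A$ with $X$ projective; enough injectives is dual. A sequence of morphisms $\cdots\to A_{1}\xrightarrow{f_1}A_2\xrightarrow{f_2}A_3\to\cdots$ is $\mathcal{E}_{\operatorname{Rk}}$-exact if each $0\to\operatorname{im}f_{i-1}\to A_i\to\operatorname{im}f_i\to0$ is a rank-exact short exact sequence. A finite $\mathcal{E}_{\operatorname{Rk}}$-projective resolution of $A$ is an $\mathcal{E}_{\operatorname{Rk}}$-exact sequence $0\to X_n\to\cdots\to X_1\to X_0\to A\to0$ with every $X_i$ $\mathcal{E}_{\operatorname{Rk}}$-projective; finite injective resolutions are defined dually. *)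

(* Defs.v *)
From HB Require Import structures.
From mathcomp Require Import all_boot all_order all_algebra.
Set Implicit Arguments.
Unset Strict Implicit.
Unset Printing Implicit Defensive.
Import Order.TTheory GRing.Theory.

Local Open Scope ring_scope.

Section Rep.
Context {k : fieldType} {d : Order.disp_t} {P : finPOrderType d}.

Record rep := Rep {
  rep_obj :> P -> vectType k;
  rep_map : forall x y : P, (x <= y)%O -> 'Hom(rep_obj x, rep_obj y);
  rep_map_id : forall (x : P) (xx : (x <= x)%O), rep_map xx = \1%VF;
  rep_map_comp : forall (x y z : P) (xy : (x <= y)%O) (yz : (y <= z)%O)
    (xz : (x <= z)%O), (rep_map yz \o rep_map xy)%VF = rep_map xz }.

Record hom (M N : rep) := Hom {
  hom_fun :> forall x : P, 'Hom(M x, N x);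
  hom_natural : forall (x y : P) (xy : (x <= y)%O),
    (hom_fun y \o rep_map M xy)%VF = (rep_map N xy \o hom_fun x)%VF }.

(* Equality of morphisms is componentwise, which avoids relying on function
   extensionality and proof irrelevance. *)
Definition hom_eq M N (f g : hom M N) : Prop := forall x, f x = g x.

Lemma hom_id_subproof (M : rep) (x y : P) (xy : (x <= y)%O) :
  (\1 \o rep_map M xy)%VF = (rep_map M xy \o \1)%VF.
Proof. by rewrite comp_lfun1l comp_lfun1r. Qed.

Definition hom_id M : hom M M :=
  @Hom M M (fun=> \1%VF) (@hom_id_subproof M).

Lemma hom_comp_subproof (L M N : rep) (g : hom M N) (f : hom L M) (x y : P)
    (xy : (x <= y)%O) :
  ((g y \o f y) \o rep_map L xy)%VF = (rep_map N xy \o (g x \o f x))%VF.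
Proof.
by rewrite -comp_lfunA hom_natural comp_lfunA hom_natural comp_lfunA.
Qed.

Definition hom_comp L M N (g : hom M N) (f : hom L M) : hom L N :=
  @Hom L N (fun x => (g x \o f x)%VF) (@hom_comp_subproof L M N g f).

Lemma hom0_subproof (M N : rep) (x y : P) (xy : (x <= y)%O) :
  (0 \o rep_map M xy)%VF = (rep_map N xy \o (0 : 'Hom(M x, N x)))%VF.
Proof. by rewrite comp_lfun0l comp_lfun0r. Qed.

Definition hom0 M N : hom M N := @Hom M N (fun=> 0) (@hom0_subproof M N).

Definition isomorphic (M N : rep) : Prop :=
  exists (f : hom M N) (g : hom N M),
    hom_eq (hom_comp g f) (hom_id M) /\ hom_eq (hom_comp f g) (hom_id N).

Definition rep0 : rep.
Proof.
refine (@Rep (fun=> 'rV[k]_0) (fun x y _ => \1%VF) _ _) => //.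
by move=> *; rewrite comp_lfun1l.
Defined.

Definition add_map (M N : rep) (x y : P) (xy : (x <= y)%O)
  (v : (M x * N x)%type) : (M y * N y)%type :=
  (rep_map M xy v.1, rep_map N xy v.2).

Lemma add_map_is_linear M N x y xy : linear (@add_map M N x y xy).
Proof. by move=> a u v; rewrite /add_map /= !linearP. Qed.

HB.instance Definition _ M N x y xy :=
  GRing.isLinear.Build k _ _ _ _ (@add_map_is_linear M N x y xy).

Definition rep_add (M N : rep) : rep.
Proof.
refine (@Rep (fun x => (M x * N x)%type)
  (fun x y xy => linfun (@add_map M N x y xy)) _ _).
- move=> x xx; apply/lfunP => -[u v]; rewrite !lfunE /= /add_map /=.
  by rewrite !rep_map_id !id_lfunE.
- move=> x y z xy yz xz; apply/lfunP => -[u v].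
  rewrite comp_lfunE !lfunE /= /add_map /=.
  by rewrite -!(rep_map_comp _ xy yz xz) !comp_lfunE.
Defined.

Definition rep_sum (s : seq rep) : rep := foldr rep_add rep0 s.

Lemma rep_map_im (M N : rep) (f : hom M N) (x y : P) (xy : (x <= y)%O)
    (v : N x) : v \in limg (f x) -> rep_map N xy v \in limg (f y).
Proof.
move=> /memv_imgP[u _ ->]; rewrite -comp_lfunE -hom_natural comp_lfunE.
exact/memv_img/memvf.
Qed.

Definition rep_im (M N : rep) (f : hom M N) : rep.
Proof.
refine (@Rep (fun x => subvs_of (limg (f x))) (fun x y xy =>
  (linfun (vsproj (limg (f y))) \o rep_map N xy
     \o linfun (@vsval k (N x) (limg (f x))))%VF) _ _).
- move=> x xx; apply/lfunP => v.
  by rewrite !comp_lfunE !lfunE /= rep_map_id id_lfunE vsvalK.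
- move=> x y z xy yz xz; apply/lfunP => v; rewrite !comp_lfunE !lfunE /=.
  by rewrite vsprojK ?rep_map_im ?subvsP// -comp_lfunE (rep_map_comp _ xy yz xz).
Defined.

Definition im_incl M N (f : hom M N) : hom (rep_im f) N.
Proof.
refine (@Hom (rep_im f) N (fun x => linfun (@vsval k (N x) (limg (f x)))) _).
move=> x y xy; apply/lfunP => v; rewrite !comp_lfunE !lfunE /=.
by rewrite vsprojK ?rep_map_im ?subvsP.
Defined.

Definition im_corestr M N (f : hom M N) : hom M (rep_im f).
Proof.
refine (@Hom M (rep_im f)
  (fun x => (linfun (vsproj (limg (f x))) \o f x)%VF) _).
move=> x y xy; apply/lfunP => v; rewrite !comp_lfunE !lfunE /=.
rewrite vsprojK ?memv_img ?memvf//.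
by rewrite -[rep_map N xy _]comp_lfunE -hom_natural comp_lfunE.
Defined.

Definition Rk (M : rep) (s t : P) (st : (s <= t)%O) : nat :=
  \dim (limg (rep_map M st)).

Definition short_exact (A B C : rep) (f : hom A B) (g : hom B C) : Prop :=
  forall x : P,
    [/\ lker (f x) = 0%VS, limg (f x) = lker (g x) & limg (g x) = fullv].

Definition rank_exact (A B C : rep) (f : hom A B) (g : hom B C) : Prop :=
  short_exact f g /\
  forall (s t : P) (st : (s <= t)%O), Rk B st = (Rk A st + Rk C st)%N.

Definition admissible_epic (B C : rep) (g : hom B C) : Prop :=
  exists (A : rep) (f : hom A B), rank_exact f g.

Definition admissible_monic (A B : rep) (f : hom A B) : Prop :=
  exists (C : rep) (g : hom B C), rank_exact f g.

(* [0 -> Hom(X, A) -> Hom(X, B) -> Hom(X, C) -> 0] is exact. *)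
Definition Hom_from_exact (X A B C : rep) (f : hom A B) (g : hom B C) : Prop :=
  [/\ forall u v : hom X A,
        hom_eq (hom_comp f u) (hom_comp f v) -> hom_eq u v,
      forall v : hom X B,
        hom_eq (hom_comp g v) (hom0 X C) <->
        exists u : hom X A, hom_eq (hom_comp f u) v
    & forall w : hom X C, exists v : hom X B, hom_eq (hom_comp g v) w].

(* [0 -> Hom(C, X) -> Hom(B, X) -> Hom(A, X) -> 0] is exact. *)
Definition Hom_to_exact (X A B C : rep) (f : hom A B) (g : hom B C) : Prop :=
  [/\ forall u v : hom C X,
        hom_eq (hom_comp u g) (hom_comp v g) -> hom_eq u v,
      forall v : hom B X,
        hom_eq (hom_comp v f) (hom0 A X) <->
        exists u : hom C X, hom_eq (hom_comp u g) v
    & forall w : hom A X, exists v : hom B X, hom_eq (hom_comp v f) w].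

Definition Rk_projective (X : rep) : Prop :=
  forall (A B C : rep) (f : hom A B) (g : hom B C),
    rank_exact f g -> Hom_from_exact X f g.

Definition Rk_injective (X : rep) : Prop :=
  forall (A B C : rep) (f : hom A B) (g : hom B C),
    rank_exact f g -> Hom_to_exact X f g.

Definition enough_projectives : Prop :=
  forall A : rep, exists (X : rep) (p : hom X A),
    Rk_projective X /\ admissible_epic p.

Definition enough_injectives : Prop :=
  forall A : rep, exists (X : rep) (i : hom A X),
    Rk_injective X /\ admissible_monic i.

(* [A -> B -> C] is E_Rk-exact at [B]: [0 -> im f -> B -> im g -> 0] is
   rank-exact. *)
Definition Rk_exact_at (A B C : rep) (f : hom A B) (g : hom B C) : Prop :=
  rank_exact (im_incl f) (im_corestr g).

Definition is_zero (M : rep) : Prop := forall x : P, \dim {:M x} = 0%N.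

(* The finite sequence [0 -> X_n -> ... -> X_0 -> A -> 0] is extended by zero
   objects [X_i] for [i > n]. *)
Definition has_finite_projective_resolution (A : rep) : Prop :=
  exists (n : nat) (X : nat -> rep) (e : hom (X 0%N) A)
         (f : forall i, hom (X i.+1) (X i)),
    [/\ forall i, (i <= n)%N -> Rk_projective (X i),
        forall i, (n < i)%N -> is_zero (X i),
        Rk_exact_at e (hom0 A rep0),
        Rk_exact_at (f 0%N) e
      & forall i, Rk_exact_at (f i.+1) (f i)].

Definition has_finite_injective_resolution (A : rep) : Prop :=
  exists (n : nat) (X : nat -> rep) (e : hom A (X 0%N))
         (f : forall i, hom (X i) (X i.+1)),
    [/\ forall i, (i <= n)%N -> Rk_injective (X i),
        forall i, (n < i)%N -> is_zero (X i),
        Rk_exact_at (hom0 rep0 A) e,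
        Rk_exact_at e (f 0%N)
      & forall i, Rk_exact_at (f i) (f i.+1)].

Definition convex (I : {set P}) : Prop :=
  forall x y z : P,
    x \in I -> z \in I -> (x <= y)%O -> (y <= z)%O -> y \in I.

(* The value at [x] is [k^1] if [x \in I] and [k^0] otherwise; the all-ones
   matrix is the identity when source and target are both [k^1]. *)
Definition indicator_rep (I : {set P}) (Iconv : convex I) : rep.
Proof.
refine (@Rep (fun x => 'rV[k]_(x \in I))
  (fun x y _ => linfun (mulmxr (const_mx 1 : 'M[k]_(x \in I, y \in I)))) _ _).
- move=> x _; apply/lfunP => v; rewrite lfunE id_lfunE /=.
  apply/rowP => j; rewrite mxE.
  case: (x \in I) v j => /= v j; last by case: j.
  by rewrite big_ord1 mxE mulr1 !ord1.
- move=> x y z xy yz _; apply/lfunP => v; rewrite comp_lfunE !lfunE /=.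
  have := @Iconv x y z; case: (x \in I) v => v.
    case: (z \in I) => h; last by apply/rowP; case.
    by rewrite h// -mulmxA; congr (v *m _); apply/matrixP => a b;
      rewrite !mxE big_ord1 !mxE mulr1.
  by move=> _; rewrite [v]thinmx0 !mul0mx.
Defined.

(* In a pair [ij : P * option P] indexing a lower hook, [None] stands for
   [+oo]; in a pair [ij : option P * P] indexing an upper hook, [None] stands
   for [-oo]. *)
Definition lower_index (ij : P * option P) : bool :=
  if ij.2 is Some j then (ij.1 < j)%O else true.

Definition upper_index (ij : option P * P) : bool :=
  if ij.1 is Some i then (i < ij.2)%O else true.

Definition lower_hook (ij : P * option P) : {set P} :=
  [set l | (ij.1 <= l)%O && (if ij.2 is Some j then ~~ (j <= l)%O else true)].

Definition upper_hook (ij : option P * P) : {set P} :=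
  [set l | (if ij.1 is Some i then ~~ (l <= i)%O else true) && (l <= ij.2)%O].

Lemma lower_hook_convex (ij : P * option P) : convex (lower_hook ij).
Proof.
case: ij => i [j|] x y z; rewrite !inE /= => /andP[ix _] /andP[_ jz] xy yz.
  by rewrite (le_trans ix xy); apply: contra jz => /le_trans; apply.
by rewrite (le_trans ix xy).
Qed.

Lemma upper_hook_convex (ij : option P * P) : convex (upper_hook ij).
Proof.
case: ij => [[i|] j] x y z; rewrite !inE /=.
  move=> /andP[ix _] /andP[_ zj] xy yz.
  by rewrite (le_trans yz zj) andbT; apply: contra ix; apply: le_trans.
by move=> _ zj _ yz; rewrite (le_trans yz zj).
Qed.

Definition lower_hook_rep (ij : P * option P) : rep :=
  indicator_rep (@lower_hook_convex ij).

Definition upper_hook_rep (ij : option P * P) : rep :=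
  indicator_rep (@upper_hook_convex ij).

Definition sum_of_lower_hooks (X : rep) : Prop :=
  exists s : seq (P * option P),
    all lower_index s /\ isomorphic X (rep_sum (map lower_hook_rep s)).

Definition sum_of_upper_hooks (X : rep) : Prop :=
  exists s : seq (option P * P),
    all upper_index s /\ isomorphic X (rep_sum (map upper_hook_rep s)).

End Rep.

Arguments rep k {d} P.
Arguments enough_projectives k {d} P.
Arguments enough_injectives k {d} P.

(* Main.v *)
(* For q = (i, j) write F_M(q) for ker (M i -> M j), or M i when j = oo; it is
   Hom(<i,j<, M).  A dimension count in the kernel sequence shows that a short
   exact sequence is rank-exact iff its epi is onto on every F(q); hence lower
   hooks are projective, and the sum of hooks <q< over bases of all F_A(q)
   covers A.  A projective splits off such a cover, and a Krull-Schmidt argument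
   using End(hook) = k makes it a sum of hooks.  If F_A(q) = 0 for all q of
   weight < n, for a weight strictly increasing on pairs, then at weight n the
   cover X -> A is bijective on F(q), so the kernel K has F_K(q) = 0 for all q
   of weight <= n; iterating kills everything after finitely many steps.
   The injective half follows by the duality rep P -> rep P^op. *)
From HB Require Import structures.
Require Import Defs.
From mathcomp Require Import all_boot all_order all_algebra.
Set Implicit Arguments.
Unset Strict Implicit.
Unset Printing Implicit Defensive.
Import Order.TTheory GRing.Theory.

Local Open Scope ring_scope.

(** * Linear maps: exactness in terms of ranks, and transposes *)

Section LinearAlgebra.
Import VectorInternalTheory.
Context {k : fieldType}.
Implicit Types U V W : vectType k.

Lemma limg_fullP V W (f : 'Hom(V, W)) :
  (limg f = fullv) <-> (forall w, exists v, f v = w).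
Proof.
split=> [fV w|f_surj].
  have /memv_imgP[v _ ->] : w \in limg f by rewrite fV memvf.
  by exists v.
apply/eqP; rewrite eqEsubv subvf; apply/subvP=> w _.
by have [v <-] := f_surj w; apply/memv_img/memvf.
Qed.

Lemma lker0_injP V W (f : 'Hom(V, W)) :
  (lker f = 0%VS) <-> (forall v, f v = 0 -> v = 0).
Proof.
split=> [f0 v fv|f_inj].
  by apply/eqP; rewrite -memv0 -f0 memv_ker fv.
apply/eqP; rewrite -subv0; apply/subvP=> v; rewrite memv_ker memv0.
by move=> /eqP/f_inj ->.
Qed.

Lemma dim_lker V W (f : 'Hom(V, W)) :
  (\dim (lker f) + \dim (limg f) = \dim {:V})%N.
Proof. by rewrite -(limg_ker_dim f fullv) capfv. Qed.

Lemma lker0_dim V W (f : 'Hom(V, W)) :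
  (lker f = 0%VS) <-> (\dim (limg f) = \dim {:V}).
Proof.
rewrite -(dim_lker f); split=> [-> | e]; first by rewrite dimv0.
apply/eqP; rewrite -dimv_eq0.
by move/eqP: e; rewrite -{1}[\dim (limg f)]add0n eqn_add2r eq_sym.
Qed.

Lemma limgf_dim V W (f : 'Hom(V, W)) :
  (limg f = fullv) <-> (\dim (limg f) = \dim {:W}).
Proof.
split=> [-> //|e]; apply/eqP.
by rewrite eqEdim subvf e leqnn.
Qed.

(** Exactness as a vanishing composite plus an equation between ranks: this form is symmetric under
    transposition. *)
Lemma limg_eq_lker U V W (f : 'Hom(U, V)) (g : 'Hom(V, W)) :
  (limg f = lker g) <->
  ((g \o f)%VF = 0 /\ (\dim (limg f) + \dim (limg g) = \dim {:V})%N).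
Proof.
rewrite -(dim_lker g); split=> [e|[gf0 /eqP]]; last rewrite eqn_add2r => /eqP e.
  split; last by rewrite e.
  apply/lfunP => u; rewrite comp_lfunE zero_lfunE; apply/eqP.
  by rewrite -memv_ker -e memv_img ?memvf.
apply/eqP; rewrite eqEdim e leqnn andbT; apply/subvP=> v /memv_imgP[u _ ->].
by rewrite memv_ker -comp_lfunE gf0 zero_lfunE.
Qed.

Lemma dim_limg_compl U V W (f : 'Hom(U, V)) (g : 'Hom(V, W)) :
  lker g = 0%VS -> \dim (limg (g \o f)) = \dim (limg f).
Proof. by move=> g0; rewrite limg_comp limg_dim_eq// g0 capv0. Qed.

Lemma limg_compr U V W (f : 'Hom(U, V)) (g : 'Hom(V, W)) :
  limg f = fullv -> limg (g \o f) = limg g.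
Proof. by move=> fV; rewrite limg_comp fV. Qed.

Lemma lker_compl U V W (f : 'Hom(U, V)) (g : 'Hom(V, W)) :
  lker g = 0%VS -> lker (g \o f) = lker f.
Proof.
move=> /lker0_injP g0; apply/vspaceP => u; rewrite !memv_ker comp_lfunE.
by apply/eqP/eqP => [/g0 //|->]; rewrite linear0.
Qed.

(* The transpose with respect to the coordinates that come with a [vectType];
   it identifies each space with its dual. *)
Definition adj V W (f : 'Hom(V, W)) : 'Hom(W, V) := Hom (f2mx f)^T.

Lemma adjK V W (f : 'Hom(V, W)) : adj (adj f) = f.
Proof. by apply: val_inj => /=; rewrite trmxK. Qed.

Lemma HomE V W (A : 'M[k]_(dim V, dim W)) v : Hom A v = r2v (v2r v *m A).
Proof. by rewrite unlock. Qed.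

Lemma adj_comp U V W (f : 'Hom(U, V)) (g : 'Hom(V, W)) :
  adj (g \o f)%VF = (adj f \o adj g)%VF.
Proof.
have -> : (g \o f)%VF = Hom (f2mx f *m f2mx g).
  apply/lfunP => u; rewrite comp_lfunE HomE mulmxA.
  by case: f g => A [B]; rewrite !HomE r2vK.
apply/lfunP => w; rewrite comp_lfunE !HomE /= trmx_mul.
by rewrite r2vK mulmxA.
Qed.

Lemma adj_id V : adj (\1%VF : 'End(V)) = \1%VF.
Proof.
have -> : \1%VF = Hom 1%:M :> 'End(V).
  by apply/lfunP => v; rewrite id_lfunE HomE mulmx1 v2rK.
by rewrite /adj /= trmx1.
Qed.

Lemma adjD V W (f g : 'Hom(V, W)) : adj (f + g) = adj f + adj g.
Proof.
have -> : f + g = Hom (f2mx f + f2mx g).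
  apply/lfunP => v; rewrite add_lfunE HomE mulmxDr linearD.
  by case: f g => A [B]; rewrite !HomE.
apply/lfunP => v; rewrite add_lfunE !HomE /=.
by rewrite linearD mulmxDr linearD.
Qed.

Lemma adj0 V W : adj (0 : 'Hom(V, W)) = 0.
Proof. by apply: (addIr (adj 0)); rewrite -adjD !add0r. Qed.

Lemma dim_limg_adj V W (f : 'Hom(V, W)) :
  \dim (limg (adj f)) = \dim (limg f).
Proof.
have H (V' W' : vectType k) (g : 'Hom(V', W')) : \dim (limg g) = \rank (f2mx g).
  rewrite unlock /dimv /lfun_img_def mx2vsK (eqmxMr _ (mx2vsK _)).
  by rewrite mul1mx.
by rewrite !H mxrank_tr.
Qed.

Lemma adj_comp0 U V W (f : 'Hom(U, V)) (g : 'Hom(V, W)) :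
  (g \o f)%VF = 0 -> (adj f \o adj g)%VF = 0.
Proof. by move=> gf0; rewrite -adj_comp gf0 adj0. Qed.

Lemma lker_adj V W (f : 'Hom(V, W)) :
  (lker (adj f) = 0%VS) <-> (limg f = fullv).
Proof.
apply: (iff_trans (lker0_dim _)); rewrite dim_limg_adj.
exact: iff_sym (limgf_dim f).
Qed.

End LinearAlgebra.

(* [vector] also exports a type [hom], which this shadows. *)
Import Defs.

(** * Representations: rank-exactness, kernels, biproducts *)

Section Representations.
Context {k : fieldType} {d : Order.disp_t} {P : finPOrderType d}.
Implicit Types (A B C M N X Y : rep k P) (q : P * option P).

(* Totalising the structure maps avoids carrying proofs of [x <= y]. *)
Definition tr M x y : 'Hom(M x, M y) :=
  if (x <= y)%O =P true is ReflectT xy then rep_map M xy else 0.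

Lemma trE M x y (xy : (x <= y)%O) : tr M x y = rep_map M xy.
Proof.
by rewrite /tr; case: eqP => // xy'; congr rep_map; apply: bool_irrelevance.
Qed.

Lemma tr_out M x y : ~~ (x <= y)%O -> tr M x y = 0.
Proof. by rewrite /tr; case: eqP => // xy /negP[]. Qed.

Lemma tr_id M x v : tr M x x v = v.
Proof. by rewrite (trE _ (lexx x)) rep_map_id id_lfunE. Qed.

Lemma tr_tr M x y z v : (x <= y)%O -> (y <= z)%O ->
  tr M y z (tr M x y v) = tr M x z v.
Proof.
move=> xy yz; have xz := le_trans xy yz.
by rewrite (trE _ xy) (trE _ yz) (trE _ xz) -comp_lfunE (rep_map_comp _ _ _ xz).
Qed.

Lemma hom_tr M N (f : hom M N) x y v : f y (tr M x y v) = tr N x y (f x v).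
Proof.
case: (boolP (x <= y)%O) => xy; last by rewrite !tr_out ?zero_lfunE ?linear0.
by rewrite !trE -!comp_lfunE hom_natural.
Qed.

(* [Hom (lower_hook_rep q, M)], by [hook_hom] and [hom_hookE] below. *)
Definition Fker M q : {vspace M q.1} :=
  if q.2 is Some j then lker (tr M q.1 j) else fullv.

Lemma hom_Fker M N (f : hom M N) q v :
  v \in Fker M q -> f q.1 v \in Fker N q.
Proof.
case: q v => i [j|] v; rewrite /Fker /= ?memvf// !memv_ker -hom_tr.
by move=> /eqP->; rewrite linear0.
Qed.

(** Read through maps out of hooks: every map from a lower hook to [C] lifts along [g]. *)
Definition Fker_onto B C (g : hom B C) : Prop :=
  forall q, lower_index q -> forall c, c \in Fker C q ->
  exists2 b, b \in Fker B q & g q.1 b = c.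

Lemma Fker_onto_limg B C (g : hom B C) x : Fker_onto g -> limg (g x) = fullv.
Proof.
move=> g_onto; apply/limg_fullP => c.
by have [|b _ <-] := g_onto (x, None) isT c; [exact: memvf | exists b].
Qed.

(** The kernels of the structure maps of [A], [B], [C] form a left exact sequence. By rank-nullity,
    ranks add up iff kernel dimensions do, that is, iff this sequence is also exact on the right. *)
Lemma RkD_lker A B C (f : hom A B) (g : hom B C) s t (st : (s <= t)%O) :
  short_exact f g ->
  Rk B st = (Rk A st + Rk C st)%N <->
  (g s @: lker (rep_map B st))%VS = lker (rep_map C st).
Proof.
move=> fg; have [f0 fg_s gC] := fg s; have [ft0 fg_t _] := fg t.
have [gf0 dimB] := (limg_eq_lker _ _).1 fg_s.
have gK : (g s @: lker (rep_map B st) <= lker (rep_map C st))%VS.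
  apply/subvP => _ /memv_imgP[b bK ->]; move: bK; rewrite !memv_ker.
  by rewrite -[rep_map C st _]comp_lfunE -hom_natural comp_lfunE => /eqP ->;
    rewrite linear0.
have KB := limg_ker_dim (g s) (lker (rep_map B st)).
(* Left exactness: a vector of the kernel that comes from [A] comes from the kernel in [A], as [f t]
   is injective. *)
have eK : (lker (rep_map B st) :&: lker (g s) = f s @: lker (rep_map A st))%VS.
  apply/vspaceP => b; rewrite memv_cap -fg_s; apply/andP/memv_imgP.
    case=> bK /memv_imgP[a _ e]; exists a => //; move: bK.
    rewrite e !memv_ker -comp_lfunE -hom_natural comp_lfunE => /eqP.
    by move/((lker0_injP _).1 ft0) => ->.
  case=> a aK ->; rewrite memv_img ?memvf//; split=> //; move: aK.
  by rewrite !memv_ker -comp_lfunE -hom_natural comp_lfunE => /eqP ->;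
    rewrite linear0.
rewrite eK limg_dim_eq ?f0 ?capv0// in KB.
rewrite ((lker0_dim _).1 f0) gC in dimB.
have := dim_lker (rep_map A st); have := dim_lker (rep_map B st).
have := dim_lker (rep_map C st); rewrite -!/(Rk _ st) => eC eB eA.
split=> [e|e]; last first.
  rewrite e in KB; apply: (@addnI (\dim (lker (rep_map B st)))).
  by rewrite eB -dimB -eA -eC -KB addnACA.
apply/eqP; rewrite eqEdim gK /=.
rewrite -(leq_add2l (\dim (lker (rep_map A st)))) KB.
rewrite -(leq_add2r (Rk B st)) eB -dimB {1}e -eA -eC addnACA leqnn.
by [].
Qed.

Lemma rank_exactP A B C (f : hom A B) (g : hom B C) :
  rank_exact f g <-> short_exact f g /\ Fker_onto g.
Proof.
split=> [[fg rk]|[fg g_onto]]; split=> //.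
  case=> i [j|] /= ij c; rewrite /Fker /=; last first.
    by have [_ _ /limg_fullP/(_ c)[b bc] _] := fg i; exists b; rewrite ?memvf.
  rewrite !(trE _ (ltW ij)) -((RkD_lker _ fg).1 (rk _ _ _)).
  by case/memv_imgP => b bK ->; exists b.
move=> s t st; apply/(RkD_lker _ fg).
(* The pair [(s, s)] is not the index of a hook, but there the structure maps are identities and
   both kernels vanish. *)
case: (eqVneq s t) => [s_eq_t|s_neq_t].
  case: _ / s_eq_t in st *; rewrite !rep_map_id.
  have ker1 (V : vectType k) : lker (\1%VF : 'End(V)) = 0%VS.
    by apply/lker0_injP => v; rewrite id_lfunE.
  by rewrite !ker1 limg0.
apply/eqP; rewrite eqEsubv; apply/andP; split; apply/subvP => c.
  case/memv_imgP => b; rewrite !memv_ker => /eqP bK ->.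
  by rewrite -comp_lfunE -hom_natural comp_lfunE bK linear0.
move=> cK; have st_lt : (s < t)%O by rewrite lt_neqAle s_neq_t.
rewrite -trE in cK; have [b bK <-] := g_onto (s, Some t) st_lt c cK.
by rewrite memv_img// -trE.
Qed.

Lemma rep_map_lker B C (g : hom B C) x y (xy : (x <= y)%O) (v : B x) :
  v \in lker (g x) -> rep_map B xy v \in lker (g y).
Proof. by rewrite !memv_ker -!trE hom_tr => /eqP->; rewrite linear0. Qed.

Definition rep_ker B C (g : hom B C) : rep k P.
Proof.
refine (@Rep _ _ _ (fun x => subvs_of (lker (g x))) (fun x y xy =>
  (linfun (vsproj (lker (g y))) \o rep_map B xy
     \o linfun (@vsval k (B x) (lker (g x))))%VF) _ _).
- move=> x xx; apply/lfunP => v.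
  by rewrite !comp_lfunE !lfunE /= rep_map_id id_lfunE vsvalK.
- move=> x y z xy yz xz; apply/lfunP => v; rewrite !comp_lfunE !lfunE /=.
  rewrite vsprojK ?rep_map_lker ?subvsP// -comp_lfunE.
  by rewrite (rep_map_comp _ xy yz xz).
Defined.

Definition ker_incl B C (g : hom B C) : hom (rep_ker g) B.
Proof.
refine (@Hom _ _ _ (rep_ker g) B
  (fun x => linfun (@vsval k (B x) (lker (g x)))) _).
move=> x y xy; apply/lfunP => v; rewrite !comp_lfunE !lfunE /=.
by rewrite vsprojK ?rep_map_lker ?subvsP.
Defined.

Lemma ker_inclE B C (g : hom B C) x (v : rep_ker g x) :
  ker_incl g x v = vsval v.
Proof. by rewrite lfunE. Qed.

Lemma ker_incl_lker B C (g : hom B C) x : lker (ker_incl g x) = 0%VS.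
Proof.
by apply/lker0_injP => v; rewrite ker_inclE => v0; apply: subvs_inj.
Qed.

Lemma limg_ker_incl B C (g : hom B C) x : limg (ker_incl g x) = lker (g x).
Proof.
apply/vspaceP => b; apply/memv_imgP/idP => [[v _ ->]|bK].
  by rewrite ker_inclE subvsP.
by exists (vsproj (lker (g x)) b); rewrite ?memvf ?ker_inclE ?vsprojK.
Qed.

Lemma rank_exact_ker B C (g : hom B C) :
  Fker_onto g -> rank_exact (ker_incl g) g.
Proof.
move=> g_onto; apply/rank_exactP; split=> // x.
by rewrite ker_incl_lker limg_ker_incl Fker_onto_limg.
Qed.

(** A pointwise inverse is automatically natural. Only the inverse is quantified, so that the lemma
    finishes a goal [isomorphic] once [f] has been chosen. *)
Lemma hom_iso M N (f : hom M N) :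
  (forall x, lker (f x) = 0%VS) -> (forall x, limg (f x) = fullv) ->
  exists g : hom N M,
    hom_eq (hom_comp g f) (hom_id M) /\ hom_eq (hom_comp f g) (hom_id N).
Proof.
move=> f_inj f_surj.
have fVK x : cancel ((f x)^-1)%VF (f x).
  by move=> v; rewrite limg_lfunVK// f_surj memvf.
have fK x : cancel (f x) ((f x)^-1)%VF by apply: lker0_lfunK; rewrite f_inj.
have g_nat x y (xy : (x <= y)%O) :
    ((f y)^-1 \o rep_map N xy)%VF = (rep_map M xy \o (f x)^-1)%VF.
  apply/lfunP => v; rewrite !comp_lfunE -{1}(fVK x v) -!trE -hom_tr.
  by rewrite fK.
exists (Hom g_nat); split=> x; apply/lfunP => v;
  by rewrite comp_lfunE id_lfunE /= ?fK ?fVK.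
Qed.

Lemma isomorphic_refl M : isomorphic M M.
Proof.
by exists (hom_id M), (hom_id M); split=> x; rewrite /= comp_lfun1l.
Qed.

Lemma isomorphic_sym M N : isomorphic M N -> isomorphic N M.
Proof. by case=> f [g [gf fg]]; exists g, f. Qed.

Lemma hom_cancelP M N (f : hom M N) (g : hom N M) :
  hom_eq (hom_comp g f) (hom_id M) <-> forall x, cancel (f x) (g x).
Proof.
split=> fK x; last by apply/lfunP => v; rewrite comp_lfunE id_lfunE fK.
by move=> v; have /lfunP/(_ v) := fK x; rewrite comp_lfunE id_lfunE.
Qed.

Lemma isomorphic_trans M N X :
  isomorphic M N -> isomorphic N X -> isomorphic M X.
Proof.
move=> [f [g [/hom_cancelP fK /hom_cancelP gK]]].
move=> [f' [g' [/hom_cancelP fK' /hom_cancelP gK']]].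
exists (hom_comp f' f), (hom_comp g g'); split; apply/hom_cancelP => x v.
  by rewrite !comp_lfunE fK' fK.
by rewrite !comp_lfunE gK gK'.
Qed.

Lemma rep_addE M N x y (xy : (x <= y)%O) (v : rep_add M N x) :
  rep_map (rep_add M N) xy v = (rep_map M xy v.1, rep_map N xy v.2).
Proof. by rewrite lfunE. Qed.

Definition hom_fst M N : hom (rep_add M N) M.
Proof.
refine (@Hom _ _ _ (rep_add M N) M (fun x => linfun fst) _) => x y xy.
by apply/lfunP => v; rewrite !comp_lfunE rep_addE !lfunE.
Defined.

Definition hom_snd M N : hom (rep_add M N) N.
Proof.
refine (@Hom _ _ _ (rep_add M N) N (fun x => linfun snd) _) => x y xy.
by apply/lfunP => v; rewrite !comp_lfunE rep_addE !lfunE.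
Defined.

Lemma hom_fstE M N x v : hom_fst M N x v = v.1.
Proof. exact: lfunE. Qed.
Lemma hom_sndE M N x v : hom_snd M N x v = v.2.
Proof. exact: lfunE. Qed.

Definition hom_copair M N X (f : hom M X) (g : hom N X) :
  hom (rep_add M N) X.
Proof.
refine (@Hom _ _ _ (rep_add M N) X
  (fun x => (f x \o hom_fst M N x)%VF + (g x \o hom_snd M N x)%VF) _) => x y xy.
apply/lfunP => v; rewrite !comp_lfunE !add_lfunE !comp_lfunE rep_addE.
by rewrite !hom_fstE !hom_sndE linearD /= -!trE !hom_tr.
Defined.

Definition pair_inl M N x (v : M x) : (M x * N x)%type := (v, 0).
Definition pair_inr M N x (v : N x) : (M x * N x)%type := (0, v).

Lemma pair_inl_linear M N x : linear (@pair_inl M N x).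
Proof. by move=> a u v; congr pair; rewrite /= scaler0 addr0. Qed.
Lemma pair_inr_linear M N x : linear (@pair_inr M N x).
Proof. by move=> a u v; congr pair; rewrite /= scaler0 addr0. Qed.

HB.instance Definition _ M N x :=
  GRing.isLinear.Build k _ _ _ _ (@pair_inl_linear M N x).
HB.instance Definition _ M N x :=
  GRing.isLinear.Build k _ _ _ _ (@pair_inr_linear M N x).

Definition hom_inl M N : hom M (rep_add M N).
Proof.
refine (@Hom _ _ _ M (rep_add M N) (fun x => linfun (@pair_inl M N x)) _).
move=> x y xy.
by apply/lfunP => v; rewrite !comp_lfunE rep_addE !lfunE /= linear0.
Defined.

Definition hom_inr M N : hom N (rep_add M N).
Proof.
refine (@Hom _ _ _ N (rep_add M N) (fun x => linfun (@pair_inr M N x)) _).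
move=> x y xy.
by apply/lfunP => v; rewrite !comp_lfunE rep_addE !lfunE /= linear0.
Defined.

Lemma hom_inlE M N x v : hom_inl M N x v = (v, 0).
Proof. exact: lfunE. Qed.
Lemma hom_inrE M N x v : hom_inr M N x v = (0, v).
Proof. exact: lfunE. Qed.
Lemma hom_copairE M N X (f : hom M X) (g : hom N X) x v :
  hom_copair f g x v = f x v.1 + g x v.2.
Proof. by rewrite add_lfunE !comp_lfunE hom_fstE hom_sndE. Qed.

Lemma tr_add M N x y v : tr (rep_add M N) x y v = (tr M x y v.1, tr N x y v.2).
Proof.
case: (boolP (x <= y)%O) => xy; last by rewrite !tr_out ?zero_lfunE.
by rewrite !trE rep_addE.
Qed.

Lemma isomorphic_add M M' N N' : isomorphic M M' -> isomorphic N N' ->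
  isomorphic (rep_add M N) (rep_add M' N').
Proof.
move=> [f [g [/hom_cancelP fK /hom_cancelP gK]]].
move=> [f' [g' [/hom_cancelP fK' /hom_cancelP gK']]].
pose F := hom_copair (hom_comp (hom_inl M' N') f) (hom_comp (hom_inr M' N') f').
have FE x v : F x v = (f x v.1, f' x v.2).
  by rewrite hom_copairE !comp_lfunE hom_inlE hom_inrE; congr pair;
    rewrite /= ?addr0 ?add0r.
exists F; apply: hom_iso => x.
  apply/lker0_injP => -[u v]; rewrite FE /= => -[fu fv].
  by congr pair; [rewrite -[u]fK fu linear0 | rewrite -[v]fK' fv linear0].
apply/limg_fullP => -[u v]; exists (g x u, g' x v).
by rewrite FE gK gK'.
Qed.

End Representations.

(** * Lower hooks: maps out of them and their projectivity *)

Section Hooks.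
Context {k : fieldType} {d : Order.disp_t} {P : finPOrderType d}.
Implicit Types (A B C M N X Y : rep k P) (q : P * option P).

(** For [n] a boolean this is the only coordinate, or [0] if there is none: vectors of an indicator
    module become scalars without case distinctions. *)
Definition row_sum n (r : 'rV[k]_n) : k := \sum_j r 0 j.

Lemma row_sum_is_linear n : linear (@row_sum n : _ -> k^o).
Proof.
move=> a r s; rewrite /row_sum scaler_sumr -big_split /=.
by apply: eq_bigr => j _; rewrite !mxE.
Qed.

HB.instance Definition _ n :=
  GRing.isLinear.Build k _ _ _ _ (@row_sum_is_linear n).

Lemma row_sum0 n : row_sum (0 : 'rV[k]_n) = 0.
Proof. by apply: big1 => j _; rewrite mxE. Qed.

Lemma row_sum_out (b : bool) (r : 'rV[k]_b) : ~~ b -> row_sum r = 0.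
Proof. by case: b r => // r _; apply: big_ord0. Qed.

Lemma row_sum_const (b : bool) (r : 'rV[k]_b) : r = row_sum r *: const_mx 1.
Proof.
apply/rowP; rewrite /row_sum; case: b r => r [[|//] //= j].
by rewrite big_ord1 !mxE mulr1; congr (r 0 _); apply: val_inj.
Qed.

Lemma row_out (b : bool) (r : 'rV[k]_b) : ~~ b -> r = 0.
Proof. by move=> /row_sum_out r0; rewrite [LHS]row_sum_const r0 scale0r. Qed.

Lemma indicator_mapE (I : {set P}) (cI : convex I) x y (xy : (x <= y)%O) r :
  rep_map (@indicator_rep k d P I cI) xy r = r *m const_mx 1.
Proof. exact: lfunE. Qed.

Lemma row_sum_map (I : {set P}) (cI : convex I) x y (xy : (x <= y)%O)
    (r : @indicator_rep k d P I cI x) :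
  row_sum (rep_map (@indicator_rep k d P I cI) xy r) =
  if y \in I then row_sum r else 0.
Proof.
rewrite indicator_mapE {1}/row_sum.
case: (y \in I); last by rewrite big_ord0.
by rewrite big_ord1 !mxE; apply: eq_bigr => j _; rewrite mxE mulr1.
Qed.

Lemma mem_lower_hook q : lower_index q -> q.1 \in lower_hook q.
Proof.
by case: q => i [j|] /= ij; rewrite inE /= lexx//= lt_geF.
Qed.

Notation hook q := (@lower_hook_rep k d P q).

Lemma row_sum_hook_map q x y (xy : (x <= y)%O) (r : hook q x) :
  row_sum (rep_map (hook q) xy r) = if y \in lower_hook q then row_sum r else 0.
Proof. exact: row_sum_map. Qed.

Definition hook_gen q : hook q q.1 := const_mx 1.

Definition scale_row n (V : vectType k) (v : V) (r : 'rV[k]_n) : V :=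
  row_sum r *: v.

Lemma scale_row_is_linear n V v : linear (@scale_row n V v).
Proof. by move=> a r s; rewrite /scale_row linearP scalerDl scalerA. Qed.

HB.instance Definition _ n V v :=
  GRing.isLinear.Build k _ _ _ _ (@scale_row_is_linear n V v).

Lemma scale_rowE n (V : vectType k) (v : V) (r : 'rV[k]_n) :
  linfun (scale_row v) r = row_sum r *: v.
Proof. exact: lfunE. Qed.

(** The generator is to go to [v]. Naturality is at stake only when a step leaves the hook, from [x]
    inside to [y] with [j <= y]; there [tr M q.1 y] factors through [j], where [v] dies. *)
Lemma hook_hom_subproof q M (v : M q.1) x y (xy : (x <= y)%O) :
  lower_index q -> v \in Fker M q ->
  (linfun (scale_row (tr M q.1 y v)) \o rep_map (hook q) xy =
   rep_map M xy \o linfun (scale_row (tr M q.1 x v)))%VF.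
Proof.
move=> qP vF; apply/lfunP => r; rewrite !comp_lfunE !scale_rowE.
rewrite row_sum_hook_map linearZ /= -trE.
case/orP: (orbN (x \in lower_hook q)) => xq; last first.
  by rewrite (row_sum_out r xq) if_same !scale0r.
have qx : (q.1 <= x)%O by move: xq; rewrite inE => /andP[].
rewrite tr_tr//.
case/orP: (orbN (y \in lower_hook q)) => yq; first by rewrite ifT.
rewrite ifN// scale0r.
case: q => i [j|] /= in v qP vF r xq qx yq *; last first.
  by rewrite inE /= (le_trans qx xy) in yq.
move: yq; rewrite inE /= (le_trans qx xy) negbK /= => jy.
move: vF; rewrite memv_ker -(tr_tr _ (ltW qP) jy) => /eqP ->.
by rewrite linear0 scaler0.
Qed.

Definition hook_hom q M (v : M q.1) (qP : lower_index q)
    (vF : v \in Fker M q) : hom (hook q) M :=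
  Hom (fun x y xy => hook_hom_subproof xy qP vF).

Lemma hook_homE q M (v : M q.1) (qP : lower_index q) (vF : v \in Fker M q) x r :
  hook_hom qP vF x r = row_sum r *: tr M q.1 x v.
Proof. exact: scale_rowE. Qed.

Lemma row_sum_gen q : lower_index q -> row_sum (hook_gen q) = 1.
Proof.
move=> /mem_lower_hook; rewrite /row_sum /hook_gen; case: (_ \in _) => // _.
by rewrite big_ord1 mxE.
Qed.

Lemma hook_hom_gen q M (v : M q.1) (qP : lower_index q) (vF : v \in Fker M q) :
  hook_hom qP vF q.1 (hook_gen q) = v.
Proof. by rewrite hook_homE row_sum_gen// scale1r tr_id. Qed.

(** Fibres are at most lines, and inside the hook the structure maps keep [row_sum]; hence
    [hook_gen] generates the hook. *)
Lemma tr_hook_gen q x (r : hook q x) : lower_index q ->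
  r = row_sum r *: tr (hook q) q.1 x (hook_gen q).
Proof.
move=> qP; case/orP: (orbN (x \in lower_hook q)) => xq; last first.
  by rewrite (row_sum_out r xq) scale0r; apply: row_out xq.
rewrite [LHS]row_sum_const; congr (_ *: _).
have qx : (q.1 <= x)%O by move: xq; rewrite inE => /andP[].
rewrite [RHS]row_sum_const trE row_sum_hook_map ifT// row_sum_gen//.
by rewrite scale1r.
Qed.

Lemma hom_hookE q M (f : hom (hook q) M) x r : lower_index q ->
  f x r = row_sum r *: tr M q.1 x (f q.1 (hook_gen q)).
Proof.
move=> qP; rewrite {1}(tr_hook_gen r qP) linearZ.
by congr (_ *: _); apply: hom_tr.
Qed.

Lemma hook_gen_Fker q : lower_index q -> hook_gen q \in Fker (hook q) q.
Proof.
case: q => i [j|] ij; rewrite /Fker ?memvf//= memv_ker.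
apply/eqP/row_out.
by rewrite inE /= lexx andbF.
Qed.

(** The fibre at [q.1] is the line spanned by the generator, so the generator goes to a multiple of
    itself. *)
Lemma hook_end q (f : hom (hook q) (hook q)) : lower_index q ->
  exists c : k, forall x r, f x r = c *: r.
Proof.
move=> qP; exists (row_sum (f q.1 (hook_gen q))) => x r.
rewrite (hom_hookE _ _ qP) [in LHS](row_sum_const (f _ _)).
by rewrite linearZ /= [in RHS](tr_hook_gen r qP) !scalerA mulrC.
Qed.

Lemma hom0E M N x v : hom0 M N x v = 0.
Proof. exact: zero_lfunE. Qed.

(** [Hom(X, -)] is left exact on every short exact sequence, so only the lifting of maps remains to
    be asked for. *)
Lemma Hom_from_exact_lift X A B C (f : hom A B) (g : hom B C) :
  short_exact f g ->
  (forall w : hom X C, exists v : hom X B, hom_eq (hom_comp g v) w) ->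
  Hom_from_exact X f g.
Proof.
move=> fg lift; split=> // [u v e x|v].
  apply/lfunP => r; have [/eqP/lker0P f_inj _ _] := fg x; apply: f_inj.
  by have /lfunP/(_ r) := e x; rewrite !comp_lfunE.
split=> [gv0|[u fu] x]; last first.
  apply/lfunP => r; rewrite comp_lfunE hom0E -(fu x) comp_lfunE.
  have [_ /limg_eq_lker[/lfunP/(_ (u x r)) gfu _] _] := fg x.
  by move: gfu; rewrite comp_lfunE zero_lfunE.
have vf x r : v x r \in limg (f x).
  have [_ -> _] := fg x; rewrite memv_ker; apply/eqP.
  by have /lfunP/(_ r) := gv0 x; rewrite comp_lfunE hom0E.
have fVK x r : f x ((f x)^-1%VF (v x r)) = v x r.
  by apply: limg_lfunVK; apply: vf.
(* A map [v] with values in the image of [f] is divided by [f] pointwise; injectivity of [f] makes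
   the result natural. *)
have u_nat x y (xy : (x <= y)%O) :
    (((f y)^-1 \o v y) \o rep_map X xy = rep_map A xy \o ((f x)^-1 \o v x))%VF.
  apply/lfunP => r; have [/eqP/lker0P f_inj _ _] := fg y; apply: f_inj.
  by rewrite !comp_lfunE fVK -!trE !hom_tr fVK.
by exists (Hom u_nat) => x; apply/lfunP => r; rewrite !comp_lfunE fVK.
Qed.

Lemma Rk_projectiveP X :
  Rk_projective X <->
  forall A B C (f : hom A B) (g : hom B C), rank_exact f g ->
  forall w : hom X C, exists v : hom X B, hom_eq (hom_comp g v) w.
Proof.
split=> Xproj A B C f g fg; first by have [] := Xproj _ _ _ _ _ fg.
by apply: Hom_from_exact_lift; [case: fg | apply: Xproj fg].
Qed.

(** A map from the hook to [C] is a choice of an element of [Fker C q]; lifting that element to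
    [Fker B q] lifts the map. *)
Lemma hook_projective q : lower_index q -> Rk_projective (hook q).
Proof.
move=> qP; apply/Rk_projectiveP => A B C f g /rank_exactP[_ g_onto] w.
have [|b bF gb] := g_onto q qP (w q.1 (hook_gen q)).
  exact/hom_Fker/hook_gen_Fker.
exists (hook_hom qP bF) => x; apply/lfunP => r.
by rewrite comp_lfunE hook_homE linearZ /= hom_tr gb -hom_hookE.
Qed.

Lemma retract_projective X Y (i : hom X Y) (r : hom Y X) :
  hom_eq (hom_comp r i) (hom_id X) -> Rk_projective Y -> Rk_projective X.
Proof.
move=> /hom_cancelP iK /Rk_projectiveP Yproj.
apply/Rk_projectiveP => A B C f g fg w.
have [v gv] := Yproj _ _ _ _ _ fg (hom_comp w r).
exists (hom_comp v i) => x; apply/lfunP => u; rewrite !comp_lfunE.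
by have /lfunP/(_ (i x u)) := gv x; rewrite !comp_lfunE iK.
Qed.

Lemma rep0_projective : Rk_projective (@rep0 k d P).
Proof.
apply/Rk_projectiveP => A B C f g fg w; exists (hom0 _ _) => x.
by apply/lfunP => r; rewrite [r]thinmx0 !linear0.
Qed.

Lemma rep_add_projective X Y :
  Rk_projective X -> Rk_projective Y -> Rk_projective (rep_add X Y).
Proof.
move=> /Rk_projectiveP Xproj /Rk_projectiveP Yproj.
apply/Rk_projectiveP => A B C f g fg w.
have [u gu] := Xproj _ _ _ _ _ fg (hom_comp w (hom_inl X Y)).
have [v gv] := Yproj _ _ _ _ _ fg (hom_comp w (hom_inr X Y)).
exists (hom_copair u v) => x; apply/lfunP => -[r s].
rewrite comp_lfunE hom_copairE linearD /=.
have /lfunP/(_ r) := gu x; have /lfunP/(_ s) := gv x.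
rewrite !comp_lfunE => -> ->.
rewrite hom_inlE hom_inrE -linearD /=.
by congr (w x (_, _)); rewrite ?addr0 ?add0r.
Qed.

Lemma rep_sum_hooks_projective s :
  all lower_index s -> Rk_projective (rep_sum [seq hook q | q <- s]).
Proof.
elim: s => [_|q s IH /= /andP[qP sP]]; first exact: rep0_projective.
by apply: rep_add_projective; [apply: hook_projective | apply: IH].
Qed.

Lemma sum_of_lower_hooks_projective X : sum_of_lower_hooks X -> Rk_projective X.
Proof.
move=> [s [sP [f [g [gf _]]]]].
exact: retract_projective gf (rep_sum_hooks_projective sP).
Qed.

End Hooks.

(** * Covers by lower hooks and the classification of projectives *)

Section Projectives.
Context {k : fieldType} {d : Order.disp_t} {P : finPOrderType d}.
Implicit Types (A B C M N X Y : rep k P) (q : P * option P).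

Notation hook q := (@lower_hook_rep k d P q).
Notation hooks s := (rep_sum [seq hook q | q <- s]).
Notation hook_index := {q : P * option P | lower_index q}.

Lemma Fker_add M N q (v : rep_add M N q.1) :
  (v \in Fker (rep_add M N) q) = (v.1 \in Fker M q) && (v.2 \in Fker N q).
Proof.
case: q v => i [j|] v; rewrite /Fker /= ?memvf// !memv_ker tr_add.
by rewrite -pair_eqE.
Qed.

(** Rank-nullity for the second projection: its image lies in [Fker N q], its kernel in the copy of
    [Fker M q]. *)
Lemma dim_Fker_add M N q :
  (\dim (Fker (rep_add M N) q) <= \dim (Fker M q) + \dim (Fker N q))%N.
Proof.
rewrite -(limg_ker_dim (hom_snd M N q.1)) leq_add//; last first.
  apply/dimvS/subvP => _ /memv_imgP[v + ->].
  by rewrite Fker_add hom_sndE => /andP[].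
apply: leq_trans (_ : \dim (hom_inl M N q.1 @: Fker M q) <= _)%N.
  apply/dimvS/subvP => -[u v]; rewrite memv_cap Fker_add memv_ker hom_sndE /=.
  by move=> /andP[/andP[uF _] /eqP->]; rewrite -hom_inlE memv_img.
by rewrite -(limg_ker_dim (hom_inl M N q.1) (Fker M q)) leq_addl.
Qed.

(** An element of [Fker M q] tagged by [q] stands for a map from the hook of [q] to [M]; the tags
    allow different hooks in one sequence. *)
Definition Fgen M : eqType := {q : hook_index & subvs_of (Fker M (val q))}.

Fixpoint cover_hom M (t : seq (Fgen M)) :
  hom (hooks [seq val (tag g) | g <- t]) M :=
  if t is g :: t' then
    hom_copair (hook_hom (valP (tag g)) (subvsP (tagged g))) (cover_hom t')
  else hom0 rep0 M.

Definition Fbasis M : seq (Fgen M) :=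
  [seq Tagged (fun q : hook_index => subvs_of (Fker M (val q))) b
     | i <- enum {: hook_index}, b <- vbasis {:subvs_of (Fker M (val i))}].

Lemma cover_hom_gen M (t : seq (Fgen M)) g : g \in t ->
  exists2 b, b \in Fker (hooks [seq val (tag g) | g <- t]) (val (tag g))
    & cover_hom t (val (tag g)).1 b = vsval (tagged g).
Proof.
elim: t => // g' t IH; rewrite inE => /predU1P[->|/IH[b bF bg]].
  exists (hook_gen (val (tag g')), 0).
    by rewrite [_ \in _]Fker_add /= mem0v andbT hook_gen_Fker// (valP (tag g')).
  by rewrite [LHS]hom_copairE hook_hom_gen linear0 addr0.
exists (0, b); first by rewrite [_ \in _]Fker_add /= mem0v.
by rewrite [LHS]hom_copairE linear0 add0r.
Qed.

Lemma cover_onto M : Fker_onto (cover_hom (Fbasis M)).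
Proof.
move=> q qP c cF; pose F := Fker M q; pose c' := vsproj F c.
have -> : c = vsval c' by rewrite vsprojK.
(* Membership in an image, a subspace, reduces to the basis vectors, each of which is the image of a
   generator. *)
suff: vsval c' \in (cover_hom (Fbasis M) q.1 @: Fker _ q)%VS.
  by case/memv_imgP => b bF ->; exists b.
rewrite (coord_vbasis (memvf c')) linear_sum; apply: memv_suml => i _.
rewrite linearZ /= memvZ//.
pose qI : hook_index := exist _ q qP.
pose g : Fgen M := Tagged (fun q : hook_index => subvs_of (Fker M (val q)))
  ((vbasis {:subvs_of (Fker M (val qI))})`_i).
have gB : g \in Fbasis M.
  apply/allpairsPdep; exists qI, (vbasis {:subvs_of F})`_i.
  by rewrite mem_enum mem_nth// size_tuple.
by have [b bF /= <-] := cover_hom_gen gB; apply: memv_img.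
Qed.

Lemma Rk_exact_cover M :
  rank_exact (ker_incl (cover_hom (Fbasis M))) (cover_hom (Fbasis M)).
Proof. exact/rank_exact_ker/cover_onto. Qed.

Lemma all_Fgen M (t : seq (Fgen M)) :
  all lower_index [seq val (tag g) | g <- t].
Proof. by apply/allP => _ /mapP[g _ ->]; apply: (valP (tag g)). Qed.

Lemma enough_projectives_hooks : enough_projectives k P.
Proof.
move=> A; exists _, (cover_hom (Fbasis A)); split; last first.
  by exists _, (ker_incl (cover_hom (Fbasis A))); apply: Rk_exact_cover.
exact/rep_sum_hooks_projective/all_Fgen.
Qed.

Definition retract X Y : Prop :=
  exists (i : hom X Y) (r : hom Y X), forall x, cancel (i x) (r x).

(* The Krull-Schmidt step.  Either the scalar [p1 q1] is invertible and [H]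
   splits off, or [q1 p1] squares to zero, so that [q' p' = 1 - q1 p1] is
   invertible. *)
Lemma split_brick X H S (p1 : hom X H) (q1 : hom H X) (p' : hom X S)
    (q' : hom S X) :
  (forall f : hom H H, exists c : k, forall x r, f x r = c *: r) ->
  (forall x v, v = q1 x (p1 x v) + q' x (p' x v)) ->
  retract X S \/ exists2 K, retract K S & isomorphic X (rep_add H K).
Proof.
move=> H_brick id_split; have [c cE] := H_brick (hom_comp p1 q1).
have p1q1 x h : p1 x (q1 x h) = c *: h by rewrite -cE comp_lfunE.
have [c0|c_neq0] := eqVneq c 0; [left|right].
  (* If [q' (p' v) = 0] then [v = q1 (p1 v)]; applying [p1] gives [p1 v = c *: p1 v = 0], hence
     [v = 0]. *)
  have th_inj x : lker (hom_comp q' p' x) = 0%VS.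
    apply/lker0_injP => v; rewrite comp_lfunE => v0.
    have vE := id_split x v; rewrite v0 addr0 in vE.
    have p1v : p1 x v = 0 by rewrite vE p1q1 c0 scale0r.
    by rewrite vE p1v linear0.
  have th_surj x : limg (hom_comp q' p' x) = fullv.
    by apply: lker0_limgf; rewrite th_inj.
  have [th [/hom_cancelP thK _]] := hom_iso th_inj th_surj.
  exists p', (hom_comp th q') => x v.
  by rewrite comp_lfunE -[RHS]thK comp_lfunE.
(* For [c] invertible, [p1] is split by [q1] up to the factor [c], so [X] is the sum of [H] and the
   kernel of [p1]. *)
pose phi := hom_copair q1 (ker_incl p1).
have phiE x h v : phi x (h, v) = q1 x h + vsval v.
  by rewrite hom_copairE ker_inclE.
have p1K x (v : rep_ker p1 x) : p1 x (vsval v) = 0.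
  by apply/eqP; rewrite -memv_ker subvsP.
have phi_inj x : lker (phi x) = 0%VS.
  apply/lker0_injP => -[h v]; rewrite phiE => hv0.
  have h0 : h = 0.
    apply/eqP; have /eqP := congr1 (p1 x) hv0.
    by rewrite linearD /= p1q1 p1K addr0 linear0 scaler_eq0 (negPf c_neq0).
  rewrite h0 linear0 add0r in hv0 *.
  by congr pair; apply: subvs_inj.
have phi_surj x : limg (phi x) = fullv.
  apply/limg_fullP => v; pose h := c^-1 *: p1 x v.
  have vK : v - q1 x h \in lker (p1 x).
    by rewrite memv_ker linearB /= p1q1 scalerA mulfV// scale1r subrr.
  exists (h, vsproj (lker (p1 x)) (v - q1 x h)).
  by rewrite phiE vsprojK// addrC subrK.
have [psi [phiK psiK]] := hom_iso phi_inj phi_surj.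
exists (rep_ker p1); last by exists psi, phi.
(* On the kernel of [p1] the map [q' p'] is the identity; [psi] followed by [hom_snd] returns to the
   kernel. *)
exists (hom_comp p' (ker_incl p1)).
exists (hom_comp (hom_snd _ _) (hom_comp psi q')) => x v.
rewrite !comp_lfunE ker_inclE hom_sndE.
have -> : q' x (p' x (vsval v)) = phi x (0, v).
  by rewrite phiE linear0 add0r [RHS](id_split x) p1K linear0 add0r.
by move/hom_cancelP: phiK => ->.
Qed.

Lemma retract_add X H S (i : hom X (rep_add H S)) (r : hom (rep_add H S) X) :
  (forall x, cancel (i x) (r x)) -> forall x v,
  v = hom_comp r (hom_inl H S) x (hom_comp (hom_fst H S) i x v) +
      hom_comp r (hom_inr H S) x (hom_comp (hom_snd H S) i x v).
Proof.
move=> iK x v; rewrite !comp_lfunE hom_fstE hom_sndE hom_inlE hom_inrE.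
rewrite -linearD -[LHS]iK; congr (r x _); case: (i x v) => a b.
by congr pair; rewrite /= ?addr0 ?add0r.
Qed.

(** Induction on [s]: either [X] is already a retract of the remaining hooks, or the first hook
    splits off from [X] and its complement is such a retract. *)
Lemma retract_hooks s X :
  all lower_index s -> retract X (hooks s) -> sum_of_lower_hooks X.
Proof.
elim: s X => [|q s IH] X /= => [_|/andP[qP sP]] [i [r iK]].
  exists [::]; split=> //; exists i; apply: hom_iso => x.
    by apply/lker0_injP => v _; rewrite -[v]iK [i x v]thinmx0 linear0.
  by apply/limg_fullP => w; exists 0; rewrite [w]thinmx0 linear0.
have H_brick f := @hook_end k d P q f qP.
have [/IH|[K /IH-/(_ sP)[s1 [s1P K_iso]] X_iso]] :=
  split_brick H_brick (retract_add iK); first exact.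
exists (q :: s1); split; first by rewrite /= qP.
exact: isomorphic_trans X_iso (isomorphic_add (isomorphic_refl _) K_iso).
Qed.

Lemma projective_hooksP X : Rk_projective X <-> sum_of_lower_hooks X.
Proof.
split; last exact: sum_of_lower_hooks_projective.
move=> /Rk_projectiveP Xproj.
(* The identity lifts along the cover, which makes [X] a retract of a sum of hooks. *)
have [i iK] := Xproj _ _ _ _ _ (Rk_exact_cover X) (hom_id X).
apply: retract_hooks (all_Fgen (Fbasis X)) _.
by exists i, (cover_hom (Fbasis X)); apply/hom_cancelP.
Qed.

End Projectives.

(** * Rank-exact complexes and finite projective resolutions *)

Section Resolutions.
Context {k : fieldType} {d : Order.disp_t} {P : finPOrderType d}.
Implicit Types (A B C D M N X Y : rep k P) (q : P * option P).

Notation hook q := (@lower_hook_rep k d P q).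
Notation hooks s := (rep_sum [seq hook q | q <- s]).
Notation hook_index := {q : P * option P | lower_index q}.

Lemma im_incl_lker A B (f : hom A B) x : lker (im_incl f x) = 0%VS.
Proof. by apply/lker0_injP => v; rewrite lfunE => v0; apply: subvs_inj. Qed.

Lemma limg_im_incl A B (f : hom A B) x : limg (im_incl f x) = limg (f x).
Proof.
apply/vspaceP => b; apply/memv_imgP/idP => [[v _ ->]|bf].
  by rewrite lfunE subvsP.
by exists (vsproj (limg (f x)) b); rewrite ?memvf// lfunE /= vsprojK.
Qed.

Lemma im_corestrE A B (f : hom A B) x v : vsval (im_corestr f x v) = f x v.
Proof. by rewrite comp_lfunE lfunE /= vsprojK// memv_img ?memvf. Qed.

Lemma Rk_im A B (f : hom A B) s t (st : (s <= t)%O) :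
  Rk (rep_im f) st = \dim (limg (rep_map B st \o f s)).
Proof.
rewrite /Rk -(dim_limg_compl _ (im_incl_lker f t)) hom_natural.
by rewrite !limg_comp limg_im_incl.
Qed.

(** The ranks of the image representations are ranks of composites with the structure maps of [B].
    Free of image objects, the condition can be composed and transposed. *)
Lemma Rk_exact_atP A B C (f : hom A B) (g : hom B C) :
  Rk_exact_at f g <->
  (forall x, limg (f x) = lker (g x)) /\
  (forall s t (st : (s <= t)%O), \dim (limg (rep_map B st)) =
     (\dim (limg (rep_map B st \o f s)) + \dim (limg (g t \o rep_map B st)))%N).
Proof.
have kerg x : lker (im_corestr g x) = lker (g x).
  apply/vspaceP => v; rewrite !memv_ker -(im_corestrE g).
  by apply/eqP/eqP => [->|v0]; last apply: subvs_inj.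
split=> [[ex rk]|[ex rk]]; split=> [x|s t st].
- by have [_ e _] := ex x; rewrite -limg_im_incl e kerg.
- by rewrite hom_natural -!Rk_im; apply: rk.
- split; rewrite ?im_incl_lker ?limg_im_incl ?kerg//.
  apply/limg_fullP => w; have /memv_imgP[v _ e] := subvsP w.
  by exists v; apply: subvs_inj; rewrite im_corestrE.
- by rewrite !Rk_im -(hom_natural g); apply: rk.
Qed.

Lemma Rk_exact_at_epi A B (e : hom A B) :
  Rk_exact_at e (hom0 B rep0) <-> forall x, limg (e x) = fullv.
Proof.
have ker0 x : lker (hom0 B rep0 x) = fullv.
  by apply/vspaceP => v; rewrite memv_ker hom0E memvf eqxx.
split=> [/Rk_exact_atP[+ _] x|e_surj]; first by move/(_ x); rewrite ker0.
apply/Rk_exact_atP; split=> [x|s t st]; first by rewrite e_surj ker0.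
by rewrite limg_compr// comp_lfun0l lim0g dimv0 addn0.
Qed.

(** With the next lemma, this splices a resolution of the kernel of a cover to the cover itself. *)
Lemma Rk_exact_at_comp_monic A B C D (f : hom A B) (g : hom B C) (i : hom C D) :
  (forall x, lker (i x) = 0%VS) -> Rk_exact_at f g ->
  Rk_exact_at f (hom_comp i g).
Proof.
move=> i_inj /Rk_exact_atP[ex rk]; apply/Rk_exact_atP; split=> [x|s t st].
  by rewrite lker_compl.
by rewrite rk -comp_lfunA (dim_limg_compl _ (i_inj t)).
Qed.

Lemma Rk_exact_at_comp_epi A B C D (e : hom A B) (f : hom B C) (g : hom C D) :
  (forall x, limg (e x) = fullv) -> rank_exact f g ->
  Rk_exact_at (hom_comp f e) g.
Proof.
move=> e_surj [fg rk]; apply/Rk_exact_atP; split=> [x|s t st].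
  by have [_ <- _] := fg x; rewrite limg_compr.
have [_ _ g_surj] := fg s; have [f_inj _ _] := fg t.
rewrite [LHS]rk comp_lfunA limg_compr// -!hom_natural dim_limg_compl//.
by rewrite hom_natural limg_compr.
Qed.

Lemma Rk_exact_at_zero A B C (f : hom A B) (g : hom B C) :
  is_zero B -> Rk_exact_at f g.
Proof.
move=> B0; have U0 x (U : {vspace B x}) : U = 0%VS.
  by have := dimvS (subvf U); rewrite B0 leqn0 dimv_eq0 => /eqP.
apply/Rk_exact_atP; split=> [x|s t st]; first by rewrite [LHS]U0 [RHS]U0.
rewrite (limg_comp _ (g t)) (U0 t (limg (rep_map B st \o f s)%VF)).
by rewrite (U0 t (limg (rep_map B st))) limg0 !dimv0.
Qed.

Definition down (x : P) : nat := #|[set y : P | (y <= x)%O]|.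

(** The down-set of [x] lies in that of [y] and has no fewer elements, so it equals it and contains
    [y]. *)
Lemma down_anti x y : (x <= y)%O -> (down y <= down x)%N -> x = y.
Proof.
move=> xy yx; have sxy : [set z | (z <= x)%O] \subset [set z | (z <= y)%O].
  by apply/subsetP => z; rewrite !inE => /le_trans; apply.
have /setP/(_ y) : [set z | (z <= x)%O] = [set z | (z <= y)%O].
  by apply/eqP; rewrite eqEcard sxy.
by rewrite !inE lexx => yx'; apply: le_anti; rewrite xy yx'.
Qed.

Lemma down_le x y : (x <= y)%O -> (down x <= down y)%N.
Proof.
move=> xy; apply/subset_leq_card/subsetP => z.
by rewrite !inE => /le_trans; apply.
Qed.

(* Strictly increasing for the product order on pairs, along which all
   nonzero maps between hooks go. *)
Definition weight q : nat :=
  (down q.1 + if q.2 is Some j then down j else #|P|.+1)%N.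

Lemma weight_bound q : (weight q < #|P| + #|P|.+2)%N.
Proof.
have le_card x : (down x <= #|P|)%N by apply: max_card.
rewrite /weight addnS ltnS leq_add//.
by case: q.2 => // j; rewrite (leq_trans (le_card j)).
Qed.

Lemma dim_hook q x : \dim {: hook q x} = (x \in lower_hook q).
Proof. by rewrite dimvf [LHS]dim_matrix; apply: mul1n. Qed.

(** A nonzero vector at [i] that dies at [j] forces [i' <= i] and puts [j] outside the hook, so
    [j' <= j]. With the bound on weights this gives [q' = q], where the fibre is a line. *)
Lemma dim_Fker_hook q' q : lower_index q -> (weight q <= weight q')%N ->
  (\dim (Fker (hook q') q) <= (q' == q))%N.
Proof.
move=> qP wq; case: eqVneq => [_|neq].
  by apply: leq_trans (dimvS (subvf _)) _; rewrite dim_hook leq_b1.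
rewrite leqn0 dimv_eq0; apply: contra_neqT neq => F_neq0.
have [v vF v_neq0] : exists2 v, v \in Fker (hook q') q & v != 0.
  by exists (vpick (Fker (hook q') q)); rewrite ?memv_pick ?vpick0.
have q_in : q.1 \in lower_hook q'.
  by apply: contraR v_neq0 => /(row_out v) ->.
have sum_neq0 : row_sum v != 0.
  by apply: contraNneq v_neq0 => v0; rewrite [v]row_sum_const v0 scale0r.
case: q q' => i oj [i' oj'] /= in qP wq F_neq0 v vF v_neq0 q_in sum_neq0 *.
have i'i : (i' <= i)%O by move: q_in; rewrite inE => /andP[].
have := down_le i'i; case: oj => [j|] /= in qP wq F_neq0 vF *.
  move: vF; rewrite memv_ker (trE _ (ltW qP)) => /eqP vF.
  (* Inside the hook the structure maps keep [row_sum], so [v] could not die at [j]. *)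
  have j_out : j \notin lower_hook (i', oj').
    apply: contraNN sum_neq0 => j_in.
    have := row_sum_hook_map (ltW qP) v; rewrite vF ifT// => <-.
    by rewrite [X in X == _]row_sum0.
  move: j_out; rewrite inE /= (le_trans i'i (ltW qP)) /=.
  clear v vF v_neq0 sum_neq0 F_neq0 q_in.
  case: oj' => [j'|] //= in wq *; rewrite negbK => j'j.
  move=> dii'; have djj := down_le j'j; rewrite /weight /= in wq.
  (* Neither summand of the weight grows from [q] to [q'], and the sum does not drop; so both stay
     equal. *)
  have -> : i' = i.
    by apply: down_anti => //; rewrite -(leq_add2r (down j))
       (leq_trans wq) ?leq_add2l.
  have -> // : j' = j.
  by apply: down_anti => //; rewrite -(leq_add2l (down i))
       (leq_trans wq) ?leq_add2r.
move=> dii'; rewrite /weight /= in wq.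
clear v vF v_neq0 sum_neq0 F_neq0 q_in.
case: oj' => [j'|] in wq *.
  (* The index [oo] counts [#|P|.+1], more than any [down j'], so a finite [j'] contradicts [wq]. *)
  have : (down i' + down j' < down i + #|P|.+1)%N.
    by rewrite addnS ltnS leq_add ?max_card.
  by rewrite ltnNge wq.
by rewrite (down_anti i'i)//; rewrite leq_add2r in wq.
Qed.

Lemma dim_Fker_hooks s q : lower_index q ->
  all (fun q' => weight q <= weight q')%N s ->
  (\dim (Fker (hooks s) q) <= count_mem q s)%N.
Proof.
move=> qP; elim: s => [_|q' s IH /andP[wq ws]].
  by apply: leq_trans (dimvS (subvf _)) _; rewrite dimvf [dim _]dim_matrix.
apply: leq_trans (dim_Fker_add (hook q') (hooks s) q) _.
by apply: leq_add; [apply: dim_Fker_hook | apply: IH].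
Qed.

Lemma count_Fbasis M q : lower_index q ->
  count_mem q [seq val (tag g) | g <- Fbasis M] = \dim (Fker M q).
Proof.
move=> qP; pose qI : hook_index := exist _ q qP.
rewrite /Fbasis map_flatten -map_comp count_flatten -map_comp.
rewrite sumnE big_map big_enum /= (bigD1 qI)//= big1 => [|i i_neq].
  rewrite addn0 !count_map (@eq_count _ _ predT) => [|b].
    by rewrite count_predT size_tuple dimvf.
  by rewrite /= eqxx.
rewrite !count_map (@eq_count _ _ pred0) ?count_pred0// => b.
by apply/negbTE; rewrite -(inj_eq val_inj) in i_neq.
Qed.

Definition weight_ge n M : Prop :=
  forall q, lower_index q -> (weight q < n)%N -> Fker M q = 0%VS.

Lemma weight_ge_ker n A :
  weight_ge n A -> weight_ge n.+1 (rep_ker (cover_hom (Fbasis A))).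
Proof.
move=> A_ge q qP; rewrite ltnS => wq.
set p := cover_hom _; set s := [seq val (tag g) | g <- Fbasis A] in p *.
(* A hook of weight below [n] does not occur in the cover: its [Fker] in [A] is zero, while basis
   vectors are nonzero. *)
have s_ge : all (fun q' => weight q <= weight q')%N s.
  apply/allP => _ /mapP[g gA ->]; apply: leq_trans wq _; rewrite leqNgt.
  apply/negP; case/allpairsPdep: gA => i [b [_ b_in ->]] /=.
  move=> /(A_ge _ (valP i)) F0.
  have /basis_not0/(_ b_in)/negP[] := vbasisP {:subvs_of (Fker A (val i))}.
  apply/eqP/subvs_inj/eqP; rewrite linear0 -memv0.
  by have /subvP := eqbRL (subv0 _) (introT eqP F0); apply; apply: subvsP.
(* The source has dimension at most the multiplicity of [q] in [s], which is [\dim (Fker A q)], and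
   [p] maps it onto [Fker A q]; hence [p] is injective on it. *)
have dim_le : (\dim (Fker (hooks s) q) <= \dim (p q.1 @: Fker (hooks s) q))%N.
  apply: leq_trans (dim_Fker_hooks qP s_ge) _; rewrite count_Fbasis//.
  apply/dimvS/subvP => c /(cover_onto qP)[b bF <-]; exact: memv_img.
have cap0 : (Fker (hooks s) q :&: lker (p q.1) = 0)%VS.
  apply/eqP; rewrite -dimv_eq0 -leqn0.
  by rewrite -(leq_add2r (\dim (p q.1 @: Fker (hooks s) q))) limg_ker_dim.
apply/eqP; rewrite -subv0; apply/subvP => v vF; rewrite memv0.
apply/eqP/subvs_inj/eqP; rewrite -memv0 -cap0 memv_cap subvsP andbT.
by have := hom_Fker (ker_incl p) vF; rewrite ker_inclE.
Qed.

Lemma rep0_zero : is_zero (@rep0 k d P).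
Proof. by move=> x; rewrite dimvf [LHS]dim_matrix. Qed.

(** Here [m] bounds the weights still to be cleared; each passage to the kernel of the cover moves
    one unit from [m] to [n]. *)
Lemma projective_resolution_weight m n A :
  (#|P| + #|P|.+2 <= m + n)%N -> weight_ge n A ->
  has_finite_projective_resolution A.
Proof.
elim: m n A => [|m IH] n A mn A_ge.
  (* All weights are now below [n], and the indices [(x, None)] give the whole spaces [A x]. *)
  have A0 : is_zero A.
    move=> x; apply/eqP; rewrite dimv_eq0.
    exact/eqP/(A_ge (x, None) isT (leq_trans (weight_bound _) mn)).
  exists 0%N, (fun=> rep0), (hom0 rep0 A), (fun=> hom0 rep0 rep0).
  split.
  - by move=> *; apply: rep0_projective.
  - by move=> *; apply: rep0_zero.
  - exact: Rk_exact_at_zero.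
  - exact/Rk_exact_at_zero/rep0_zero.
  - by move=> i; apply/Rk_exact_at_zero/rep0_zero.
pose p := cover_hom (Fbasis A).
have [||l [X [e [f [Xproj X0 e_epi fe ff]]]]] := IH n.+1 (rep_ker p).
- by rewrite addSnnS in mn.
- exact: weight_ge_ker.
pose X' i := if i is j.+1 then X j else hooks [seq val (tag g) | g <- Fbasis A].
pose f' i : hom (X' i.+1) (X' i) :=
  if i is j.+1 then f j else hom_comp (ker_incl p) e.
exists l.+1, X', p, f'; split.
- case=> [_|i]; last exact: Xproj.
  exact/rep_sum_hooks_projective/all_Fgen.
- by case=> // i; apply: X0.
- by apply/Rk_exact_at_epi => x; apply/Fker_onto_limg/cover_onto.
- apply: Rk_exact_at_comp_epi (Rk_exact_cover A).
  exact/Rk_exact_at_epi.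
- case=> [|i]; last exact: ff.
  by apply: Rk_exact_at_comp_monic fe; apply: ker_incl_lker.
Qed.

Lemma finite_projective_resolution A : has_finite_projective_resolution A.
Proof.
by apply: (@projective_resolution_weight (#|P| + #|P|.+2) 0); rewrite ?addn0.
Qed.

End Resolutions.

(** * Criteria for injectivity and recognition of lower hooks *)

Section Injectives.
Context {k : fieldType} {d : Order.disp_t} {P : finPOrderType d}.
Implicit Types (A B C M N X Y : rep k P).

Lemma Hom_to_exact_extend X A B C (f : hom A B) (g : hom B C) :
  short_exact f g ->
  (forall w : hom A X, exists v : hom B X, hom_eq (hom_comp v f) w) ->
  Hom_to_exact X f g.
Proof.
move=> fg ext; have g_surj x : forall c, exists b, g x b = c.
  by apply/limg_fullP; have [_ _ ->] := fg x.
split=> // [u v e x|v].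
  apply/lfunP => c; have [b <-] := g_surj x c.
  by have /lfunP/(_ b) := e x; rewrite !comp_lfunE.
split=> [vf0|[u ug] x]; last first.
  apply/lfunP => a; rewrite comp_lfunE hom0E -(ug x) comp_lfunE.
  have [_ /limg_eq_lker[/lfunP/(_ a) gfa _] _] := fg x.
  by move: gfa; rewrite comp_lfunE zero_lfunE => ->; rewrite linear0.
(* [(g x)^-1] is a linear right inverse of [g x], so both arguments differ by an element of the
   kernel of [g x], the image of [f x], where [v] vanishes. *)
have vg x b : v x ((g x)^-1%VF (g x b)) = v x b.
  apply/eqP; rewrite -subr_eq0 -linearB; apply/eqP.
  have [_ ex _] := fg x; set b' := (_ - _).
  have /memv_imgP[a _ ->] : b' \in limg (f x).
    by rewrite ex memv_ker linearB /= limg_lfunVK ?memv_img ?memvf// subrr.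
  by have /lfunP/(_ a) := vf0 x; rewrite comp_lfunE hom0E.
have u_nat x y (xy : (x <= y)%O) :
    ((v y \o (g y)^-1) \o rep_map C xy = rep_map X xy \o (v x \o (g x)^-1))%VF.
  apply/lfunP => c; have [b <-] := g_surj x c.
  by rewrite !comp_lfunE vg -!trE -hom_tr vg hom_tr.
by exists (Hom u_nat) => x; apply/lfunP => b; rewrite !comp_lfunE vg.
Qed.

Lemma Rk_injectiveP X :
  Rk_injective X <->
  forall A B C (f : hom A B) (g : hom B C), rank_exact f g ->
  forall w : hom A X, exists v : hom B X, hom_eq (hom_comp v f) w.
Proof.
split=> Xinj A B C f g fg; first by have [] := Xinj _ _ _ _ _ fg.
by apply: Hom_to_exact_extend; [case: fg | apply: Xinj fg].
Qed.

Lemma isomorphic_injective X Y :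
  isomorphic X Y -> Rk_injective Y -> Rk_injective X.
Proof.
move=> [i [r [/hom_cancelP iK _]]] /Rk_injectiveP Yinj.
apply/Rk_injectiveP => A B C f g fg w.
have [v vf] := Yinj _ _ _ _ _ fg (hom_comp i w).
exists (hom_comp r v) => x; apply/lfunP => u; rewrite !comp_lfunE.
by have /lfunP/(_ u) := vf x; rewrite !comp_lfunE => ->; rewrite iK.
Qed.

Lemma Rk_exact_at_monic A B (e : hom A B) :
  Rk_exact_at (hom0 rep0 A) e <-> forall x, lker (e x) = 0%VS.
Proof.
have im0 x : limg (hom0 rep0 A x) = 0%VS.
  apply/eqP; rewrite -subv0; apply/subvP => _ /memv_imgP[v _ ->].
  by rewrite hom0E mem0v.
split=> [/Rk_exact_atP[+ _] x|e_inj]; first by move/(_ x) => <-.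
apply/Rk_exact_atP; split=> [x|s t st]; first by rewrite e_inj im0.
by rewrite (limg_comp _ (rep_map A st)) im0 limg0 dimv0 dim_limg_compl.
Qed.

Lemma isomorphic_zero M N : is_zero M -> is_zero N -> isomorphic M N.
Proof.
move=> M0 N0; exists (hom0 M N); apply: hom_iso => x.
  apply/lker0_dim/eqP; rewrite M0 -leqn0 -(N0 x).
  exact/dimvS/subvf.
apply/limgf_dim/eqP; rewrite N0 -leqn0 -(N0 x).
exact/dimvS/subvf.
Qed.

(** A nonzero [v] at [q.1] lies in [Fker M q], as [M] vanishes at [j]. The map it defines on the
    hook is injective, and dimensions agree. This recognises duals of upper hooks without comparing
    matrices. *)
Lemma lower_hook_iso M (q : P * option P) : lower_index q ->
  (forall x, \dim {: M x} = (x \in lower_hook q)) ->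
  (forall x, x \in lower_hook q -> lker (tr M q.1 x) = 0%VS) ->
  isomorphic (@lower_hook_rep k d P q) M.
Proof.
move=> qP dimM tr_inj; pose v := vpick {: M q.1}.
have v_neq0 : v != 0.
  by rewrite vpick0 -dimv_eq0 dimM mem_lower_hook.
have vF : v \in Fker M q.
  rewrite /Fker; case E: q.2 => [j|]; rewrite ?memvf// memv_ker.
  have /eqP : \dim {: M j} = 0%N by rewrite dimM inE E lexx andbF.
  by rewrite dimv_eq0 -memv0 => /eqP <-; apply: memvf.
have h_inj x : lker (hook_hom qP vF x) = 0%VS.
  apply/lker0_injP => r; rewrite hook_homE => /eqP.
  case/orP: (orbN (x \in lower_hook q)) => xq; last by rewrite (row_out r xq).
  rewrite scaler_eq0 => /orP[/eqP r0|/eqP].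
    by rewrite [r]row_sum_const r0 scale0r.
  by move=> /((lker0_injP _).1 (tr_inj x xq))/eqP; rewrite (negPf v_neq0).
exists (hook_hom qP vF); apply: hom_iso => // x.
by apply/limgf_dim; rewrite ((lker0_dim _).1 (h_inj x)) dimM dim_hook.
Qed.

End Injectives.

(** * Transposition along an order-reversing map *)

Section Opposite.
Context {k : fieldType} {d d' : Order.disp_t}.
Context {P : finPOrderType d} {Q : finPOrderType d'}.
Variable sigma : Q -> P.
Hypothesis sigma_anti : forall x y : Q, (x <= y)%O -> (sigma y <= sigma x)%O.
Implicit Types (A B C M N : rep k P).

Lemma rep_op_id_subproof M (x : Q) (xx : (x <= x)%O) :
  adj (rep_map M (sigma_anti xx)) = \1%VF.
Proof. by rewrite rep_map_id adj_id. Qed.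

Lemma rep_op_comp_subproof M (x y z : Q) (xy : (x <= y)%O) (yz : (y <= z)%O)
    (xz : (x <= z)%O) :
  (adj (rep_map M (sigma_anti yz)) \o adj (rep_map M (sigma_anti xy)))%VF =
  adj (rep_map M (sigma_anti xz)).
Proof. by rewrite -adj_comp (rep_map_comp _ _ _ (sigma_anti xz)). Qed.

(** An arbitrary antitone [sigma] lets one construction serve both from [P] to [P^d] and back. *)
Definition rep_op M : rep k Q :=
  @Rep k d' Q (fun x => M (sigma x))
    (fun x y xy => adj (rep_map M (sigma_anti xy)))
    (@rep_op_id_subproof M) (@rep_op_comp_subproof M).

Lemma hom_op_subproof M N (f : hom M N) (x y : Q) (xy : (x <= y)%O) :
  (adj (f (sigma y)) \o rep_map (rep_op N) xy)%VF =
  (rep_map (rep_op M) xy \o adj (f (sigma x)))%VF.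
Proof.
have := congr1 (@adj _ _ _) (hom_natural f (sigma_anti xy)).
by rewrite !adj_comp => /esym.
Qed.

Definition hom_op M N (f : hom M N) : hom (rep_op N) (rep_op M) :=
  @Hom k d' Q (rep_op N) (rep_op M) (fun x => adj (f (sigma x)))
    (@hom_op_subproof M N f).

Lemma short_exact_op A B C (f : hom A B) (g : hom B C) :
  short_exact f g -> short_exact (hom_op g) (hom_op f).
Proof.
move=> fg x; have := fg (sigma x).
move=> [/lker0_dim f_inj /limg_eq_lker[gf0 dimB] /limgf_dim g_surj].
split; first by apply/lker0_dim; rewrite dim_limg_adj.
  apply/limg_eq_lker; split; first exact: adj_comp0.
  by rewrite !dim_limg_adj addnC.
by apply/limgf_dim; rewrite dim_limg_adj.
Qed.

Lemma rank_exact_op A B C (f : hom A B) (g : hom B C) :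
  rank_exact f g -> rank_exact (hom_op g) (hom_op f).
Proof.
move=> [fg rk]; split=> [|s t st]; first exact: short_exact_op.
by rewrite /Rk !dim_limg_adj addnC; apply: rk.
Qed.

Lemma Rk_exact_at_op A B C (f : hom A B) (g : hom B C) :
  Rk_exact_at f g -> Rk_exact_at (hom_op g) (hom_op f).
Proof.
move=> /Rk_exact_atP[ex rk]; apply/Rk_exact_atP; split=> [x|s t st].
  have /limg_eq_lker[gf0 dimB] := ex (sigma x).
  apply/limg_eq_lker; split; first exact: adj_comp0.
  by rewrite !dim_limg_adj addnC.
by rewrite -!adj_comp !dim_limg_adj addnC; apply: rk.
Qed.

Lemma isomorphic_op M N : isomorphic M N -> isomorphic (rep_op M) (rep_op N).
Proof.
move=> [f [g [gf fg]]]; exists (hom_op g), (hom_op f); split=> x.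
  by have := congr1 (@adj _ _ _) (gf (sigma x)); rewrite adj_comp adj_id.
by have := congr1 (@adj _ _ _) (fg (sigma x)); rewrite adj_comp adj_id.
Qed.

Lemma rep_op_zero M : is_zero M -> is_zero (rep_op M).
Proof. by move=> M0 x; apply: M0. Qed.

(** The transposed projections form the map and the transposed inclusions its inverse, by the
    biproduct identities; the coordinates on the product are never opened. *)
Lemma rep_op_add M N :
  isomorphic (rep_add (rep_op M) (rep_op N)) (rep_op (rep_add M N)).
Proof.
pose F := hom_copair (hom_op (hom_fst M N)) (hom_op (hom_snd M N)).
have FE x v w : F x (v, w) =
    adj (hom_fst M N (sigma x)) v + adj (hom_snd M N (sigma x)) w.
  by rewrite hom_copairE.
exists F; apply: hom_iso => x.
  apply/lker0_injP => -[v w]; rewrite FE => e.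
  have inl_fst : (hom_fst M N (sigma x) \o hom_inl M N (sigma x))%VF = \1%VF.
    by apply/lfunP => u; rewrite comp_lfunE hom_inlE hom_fstE id_lfunE.
  have inr_snd : (hom_snd M N (sigma x) \o hom_inr M N (sigma x))%VF = \1%VF.
    by apply/lfunP => u; rewrite comp_lfunE hom_inrE hom_sndE id_lfunE.
  have inl_snd : (hom_snd M N (sigma x) \o hom_inl M N (sigma x))%VF = 0.
    by apply/lfunP => u; rewrite comp_lfunE hom_inlE hom_sndE zero_lfunE.
  have inr_fst : (hom_fst M N (sigma x) \o hom_inr M N (sigma x))%VF = 0.
    by apply/lfunP => u; rewrite comp_lfunE hom_inrE hom_fstE zero_lfunE.
  have := congr1 (adj (hom_inl M N (sigma x))) e.
  have := congr1 (adj (hom_inr M N (sigma x))) e.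
  rewrite !linearD !linear0 /= -![adj _ (adj _ _)]comp_lfunE -!adj_comp.
  rewrite inl_fst inr_snd inl_snd inr_fst !adj_id !adj0 !id_lfunE !zero_lfunE.
  by rewrite add0r addr0 => -> ->.
apply/limg_fullP => w.
exists (adj (hom_inl M N (sigma x)) w, adj (hom_inr M N (sigma x)) w).
rewrite FE -!comp_lfunE -!adj_comp -add_lfunE -adjD.
rewrite (_ : _ + _ = \1%VF) ?adj_id ?id_lfunE//; apply/lfunP => v.
rewrite add_lfunE !comp_lfunE hom_fstE hom_sndE hom_inlE hom_inrE id_lfunE.
by case: v => a b; congr pair; rewrite /= ?addr0 ?add0r.
Qed.

End Opposite.

(** * Duality between [P] and [P^d], and the injective half *)

Section Duality.
Context {k : fieldType} {d : Order.disp_t} {P : finPOrderType d}.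
Implicit Types (A B C M N X : rep k P) (S Y : rep k P^d).

Definition dual X : rep k P^d :=
  @rep_op k d _ P P^d id (fun x y yx => yx) X.

Definition predual Y : rep k P :=
  @rep_op k _ d P^d P id (fun x y yx => yx) Y.

Definition dual_hom A B (f : hom A B) : hom (dual B) (dual A) := hom_op _ f.

Definition predual_hom S Y (f : hom S Y) : hom (predual Y) (predual S) :=
  hom_op _ f.

Lemma dual_rank_exact A B C (f : hom A B) (g : hom B C) :
  rank_exact f g -> rank_exact (dual_hom g) (dual_hom f).
Proof. exact: rank_exact_op. Qed.

Lemma predual_rank_exact S S' S'' (f : hom S S') (g : hom S' S'') :
  rank_exact f g -> rank_exact (predual_hom g) (predual_hom f).
Proof. exact: rank_exact_op. Qed.

Lemma predual_Rk_exact_at S S' S'' (f : hom S S') (g : hom S' S'') :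
  Rk_exact_at f g -> Rk_exact_at (predual_hom g) (predual_hom f).
Proof. exact: Rk_exact_at_op. Qed.

(* [flip] and [unflip] form the adjunction Hom(Y, dual X) = Hom(X, predual Y);
   all components are plain transposes because [dual] does not change spaces. *)
Definition flip Y X (h : hom Y (dual X)) : hom X (predual Y).
Proof.
refine (@Hom _ _ _ X (predual Y) (fun x => adj (h x)) _) => x y xy.
have := congr1 (@adj _ _ _) (@hom_natural _ _ _ _ _ h y x xy).
by rewrite !adj_comp adjK => /esym.
Defined.

Definition unflip Y X (h : hom X (predual Y)) : hom Y (dual X).
Proof.
refine (@Hom _ _ _ Y (dual X) (fun x => adj (h x)) _) => x y xy.
have := congr1 (@adj _ _ _) (@hom_natural _ _ _ _ _ h y x xy).
by rewrite !adj_comp adjK => /esym.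
Defined.

Definition coflip Y X (h : hom (predual Y) X) : hom (dual X) Y.
Proof.
refine (@Hom _ _ _ (dual X) Y (fun x => adj (h x)) _) => x y xy.
have := congr1 (@adj _ _ _) (@hom_natural _ _ _ _ _ h y x xy).
by rewrite !adj_comp adjK => /esym.
Defined.

(** Double transposition fixes the structure maps only up to a proved equality, hence an
    isomorphism, with identity components. *)
Lemma predual_dual X : isomorphic X (predual (dual X)).
Proof.
exists (flip (hom_id (dual X))); apply: hom_iso => x /=; rewrite adj_id.
  by apply/lker0_injP => v; rewrite id_lfunE.
by rewrite lim1g.
Qed.

(** An extension problem into [predual Y] transposes to a lifting problem out of [Y]. *)
Lemma predual_injective Y : Rk_projective Y -> Rk_injective (predual Y).
Proof.
move=> /Rk_projectiveP Yproj; apply/Rk_injectiveP => A B C f g fg w.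
have [v fv] := Yproj _ _ _ _ _ (dual_rank_exact fg) (unflip w).
exists (flip v) => x; have := congr1 (@adj _ _ _) (fv x).
by rewrite /= adj_comp !adjK.
Qed.

Lemma enough_injectives_dual : enough_injectives k P.
Proof.
move=> A; have := enough_projectives_hooks (dual A).
move=> [S [p [Sproj [K [j [jp rk]]]]]].
exists (predual S), (flip p); split; first exact: predual_injective.
exists (predual K), (predual_hom j).
(* [flip p] has the components of [predual_hom p], with source [A] in place of [predual (dual A)];
   short exactness is literally the same, and ranks survive double transposition. *)
have [jp' rk'] := predual_rank_exact (conj jp rk).
split=> [x|s t st]; first exact: jp'.
by rewrite rk'; congr addn; rewrite /Rk !dim_limg_adj.
Qed.

Lemma injective_resolution_dual A : has_finite_injective_resolution A.
Proof.
have [n [X [e [f [Xproj X0 e_epi fe ff]]]]] :=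
  finite_projective_resolution (dual A).
exists n, (fun i => predual (X i)), (flip e), (fun i => predual_hom (f i)).
split=> [i le_in|i lt_ni|||i].
- exact/predual_injective/Xproj.
- exact/rep_op_zero/X0.
- apply/Rk_exact_at_monic => x; apply/lker_adj.
  by move/Rk_exact_at_epi: e_epi => ->.
- have /Rk_exact_atP fe' := predual_Rk_exact_at fe.
  exact/Rk_exact_atP.
- exact: predual_Rk_exact_at.
Qed.

(** Reversing the order exchanges upper and lower hooks and turns [-oo] into [+oo], both encoded as
    [None]. *)
Definition swap_index (ij : option P * P) : P^d * option P^d := (ij.2, ij.1).

Lemma upper_hook_swap ij : upper_hook ij = lower_hook (swap_index ij).
Proof.
by case: ij => [[i|] j]; apply/setP => l; rewrite !inE /= ?andbT// andbC.
Qed.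

Lemma predual_lower_hook ij : upper_index ij ->
  isomorphic (predual (lower_hook_rep (swap_index ij)))
             (@upper_hook_rep k d P ij).
Proof.
move=> ijP; have qP : lower_index (swap_index ij) by case: ij ijP => [[i|] j].
(* By double duality it suffices to compare over [P^d], where the dual of the upper hook is
   recognised as a lower hook. *)
apply: isomorphic_trans (isomorphic_sym (predual_dual _)).
apply: isomorphic_op; apply: lower_hook_iso => // x.
  by rewrite -upper_hook_swap dimvf [LHS]dim_matrix; apply: mul1n.
rewrite -upper_hook_swap => x_in.
have xj : @Order.le d P x ij.2 by move: x_in; rewrite inE => /andP[].
have j_in : ij.2 \in upper_hook ij.
  by rewrite upper_hook_swap; apply: (mem_lower_hook qP).
rewrite (@trE _ _ _ (dual _) _ _ xj); apply/lker_adj.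
(* Inside the upper hook this map is injective between lines, so onto, so its transpose is
   injective. *)
have map_inj : lker (rep_map (@upper_hook_rep k d P ij) xj) = 0%VS.
  apply/lker0_injP => r r0.
  have := row_sum_map (cI := @upper_hook_convex d P ij) xj r.
  by rewrite [X in row_sum X]r0 row_sum0 j_in => /esym s0;
     rewrite [r]row_sum_const s0 scale0r.
apply/limgf_dim; rewrite ((lker0_dim _).1 map_inj) !dimvf.
by rewrite [LHS]dim_matrix [RHS]dim_matrix x_in j_in.
Qed.

Lemma predual_hooks s : all upper_index s ->
  isomorphic (predual (rep_sum [seq lower_hook_rep (swap_index ij) | ij <- s]))
             (rep_sum [seq @upper_hook_rep k d P ij | ij <- s]).
Proof.
elim: s => [_|ij s IH /andP[ijP sP]].
  by apply: isomorphic_zero; [apply: rep_op_zero|]; apply: rep0_zero.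
apply: isomorphic_trans (isomorphic_sym (rep_op_add _ _ _)) _.
exact: isomorphic_add (predual_lower_hook ijP) (IH sP).
Qed.

Lemma sum_of_upper_hooksP X :
  sum_of_upper_hooks X <->
  exists2 Y, sum_of_lower_hooks Y & isomorphic X (predual Y).
Proof.
split=> [[s [sP Xs]]|[Y [s [sP Ys]] XY]].
  exists (rep_sum [seq lower_hook_rep (swap_index ij) | ij <- s]).
    exists (map swap_index s); rewrite -map_comp; split.
      by rewrite all_map; apply: sub_all sP => -[[i|] j].
    exact: isomorphic_refl.
  exact: isomorphic_trans Xs (isomorphic_sym (predual_hooks sP)).
pose s' : seq (option P * P) := [seq (q.2, q.1) | q <- s].
exists s'; have s'P : all upper_index s'.
  by rewrite all_map; apply: sub_all sP => -[i [j|]].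
split=> //; apply: isomorphic_trans XY _.
apply: isomorphic_trans (predual_hooks s'P).
apply: isomorphic_op; rewrite -map_comp.
by rewrite (@eq_map _ _ _ (@lower_hook_rep k _ P^d)) // => -[].
Qed.

Lemma injective_hooksP X : Rk_injective X <-> sum_of_upper_hooks X.
Proof.
split=> [/Rk_injectiveP Xinj|/sum_of_upper_hooksP[Y Y_hooks XY]]; last first.
  apply: isomorphic_injective XY _.
  exact/predual_injective/sum_of_lower_hooks_projective.
apply/sum_of_upper_hooksP; exists (dual X); last exact: predual_dual.
pose p := cover_hom (Fbasis (dual X)).
have [jp' rk'] := predual_rank_exact (Rk_exact_cover (dual X)).
have flip_p : rank_exact (flip p) (predual_hom (ker_incl p)).
  split=> [x|s t st]; first exact: jp'.
  by rewrite rk'; congr addn; rewrite /Rk !dim_limg_adj.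
(* The identity of [X] extends along the embedding [flip p]; the transpose of the extension [r] is a
   section of [p], so [dual X] is a retract of a sum of lower hooks. *)
have [r rp] := Xinj _ _ _ _ _ flip_p (hom_id X).
apply: retract_hooks (all_Fgen (Fbasis (dual X))) _.
exists (coflip r), p; apply/hom_cancelP => x.
by have := congr1 (@adj _ _ _) (rp x); rewrite adj_comp adjK adj_id.
Qed.

End Duality.

Theorem theorem4p11 (k : fieldType) (d : Order.disp_t) (P : finPOrderType d) :
  [/\ enough_projectives k P
      /\ (forall X : rep k P, Rk_projective X <-> sum_of_lower_hooks X),
      enough_injectives k P
      /\ (forall X : rep k P, Rk_injective X <-> sum_of_upper_hooks X),
      forall A : rep k P, has_finite_projective_resolution A
    & forall A : rep k P, has_finite_injective_resolution A].
Proof.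
split.
- by split; [apply: enough_projectives_hooks | apply: projective_hooksP].
- by split; [apply: enough_injectives_dual | apply: injective_hooksP].
- exact: finite_projective_resolution.
- exact: injective_resolution_dual.
Qed.
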